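(* Let $P$ be the uniform distribution on the closed unit disc $D=\{(x_1,x_2)\in\mathbb R^2: x_1^2+x_2^2\le 1\}$. Assume that every optimal set of five-means for $P$ is either the vertex set of a regular pentagon centered at the origin, or consists of the origin together with the vertices of a square centered at the origin. Then there are uncountably many optimal sets of five-means for $P$, the quantization error is $V_5(P)=0.111049$ (decimal approximation, i.e. $|V_5(P)-0.111049|<10^{-6}$), and there is a number $c$ with $|c-0.388951|<10^{-6}$ such that the five points of any optimal set of five-means form a regular pentagon inscribed in the circle $x_1^2+x_2^2=c$.
   Context: The uniform distribution on $D$ is the Borel probability measure with density $\frac1\pi$ on $D$ and $0$ elsewhere with respect to Lebesgue measure. For a Borel probability measure $P$ on $\mathbb R^d$ and $n\ge1$, the $n$th quantization error is $V_n(P)=\inf\{\int \min_{a\in\alpha}\|x-a\|^2\,dP(x):\alpha\subset\mathbb R^d,\ \mathrm{card}(\alpha)\le n\}$, where $\|\cdot\|$ is the Euclidean norm. A set $\alpha$ with $\mathrm{card}(\alpha)\le n$ attaining the infimum is called an optimal set of $n$-means; for absolutely continuous $P$ it has exactly $n$ elements. *)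

(* Defs.v *)
From HB Require Import structures.
From mathcomp Require Import all_boot all_order all_algebra.
From mathcomp Require Import ring lra.
From mathcomp Require Import all_classical all_reals all_analysis.
From mathcomp Require Import measurable_realfun.
Set Implicit Arguments.
Unset Strict Implicit.
Unset Printing Implicit Defensive.
Import Order.TTheory GRing.Theory Num.Theory.
Import numFieldNormedType.Exports.
Local Open Scope classical_set_scope.
Local Open Scope ring_scope.

Section planar_sets.
Context {R : realType}.
Implicit Types (x a : R * R) (alpha : set (R * R)).

(* The library norm on R * R is the sup norm, so the squared Euclidean
   distance is spelled out. *)
Definition sqdist x a : R := (x.1 - a.1) ^+ 2 + (x.2 - a.2) ^+ 2.

Definition unit_disc : set (R * R) := [set x | x.1 ^+ 2 + x.2 ^+ 2 <= 1].

Definition circle0 (c : R) : set (R * R) := [set x | x.1 ^+ 2 + x.2 ^+ 2 = c].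

(* Vertex set of a (nondegenerate) regular n-gon centered at the origin. *)
Definition regular_polygon0 (n : nat) alpha : Prop :=
  exists r t : R, 0 < r /\
    alpha = [set (r * cos (t + 2 * pi * k%:R / n%:R),
                  r * sin (t + 2 * pi * k%:R / n%:R)) | k in `I_n].

End planar_sets.

Section quantization.
Context {R : realType}.
Implicit Types (P : probability (R * R)%type R) (alpha : set (R * R)).

(* The infimum over a finite nonempty alpha is a minimum; the empty set is
   harmless, as it yields the integral of +oo. *)
Definition distortion P alpha : \bar R :=
  (\int[P]_x ereal_inf [set (sqdist x a)%:E | a in alpha])%E.

Definition quantization_error P (n : nat) : \bar R :=
  ereal_inf [set distortion P alpha | alpha in [set alpha | (alpha #<= `I_n)%card]].

Definition optimal_means P (n : nat) alpha : Prop :=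
  (alpha #<= `I_n)%card /\ distortion P alpha = quantization_error P n.

End quantization.

Section uniform_disc.
Context (R : realType).
Local Notation mu := (@lebesgue_measure R).

Definition uniform_disc_pdf (x : R * R) : R := pi^-1 * \1_unit_disc x.

Definition uniform_disc : set (R * R) -> \bar R :=
  fun A => (\int[mu \x mu]_(x in A) (uniform_disc_pdf x)%:E)%E.

Lemma measurable_unit_disc : measurable (@unit_disc R).
Proof.
have mf : measurable_fun [set: R * R] (fun x : R * R => x.1 ^+ 2 + x.2 ^+ 2).
  apply: measurable_funD; apply: measurable_funX;
    [exact: measurable_fst | exact: measurable_snd].
rewrite (_ : unit_disc = setT `&`
    (fun x : R * R => x.1 ^+ 2 + x.2 ^+ 2) @^-1` `]-oo, 1%R]); last first.
  by apply/seteqP; split => x /=; rewrite in_itv/=; [split|case].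
exact: mf.
Qed.

Let half_width (x : R) : R := Num.sqrt (1 - x ^+ 2) * 2.

Let continuous_half_width : continuous half_width.
Proof.
move=> x; apply: (@cvgM _ _ _ _ (fun x : R => Num.sqrt (1 - x ^+ 2)) (cst 2));
  last exact: cvg_cst.
apply: (@continuous_comp _ _ _ (fun x : R => 1 - x ^+ 2) Num.sqrt);
  last exact: sqrt_continuous.
by apply: cvgB; [exact: cvg_cst|exact: exprn_continuous].
Qed.

Let F (t : R) : R := t + sin t * cos t.

Let is_derive_F (t : R) : is_derive t 1 F (cos t ^+ 2 * 2).
Proof.
rewrite /F; apply: is_derive_eq.
rewrite /GRing.scale/= -[X in X + _](cos2Dsin2 t).
by ring.
Qed.

Let integral_half_width :
  (\int[mu]_(x in `[(-1)%R, 1%R]) (half_width x)%:E = (pi : R)%:E)%E.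
Proof.
have pi0 : - (pi / 2) < (pi / 2 : R) by rewrite gtrN// divr_gt0// pi_gt0.
have dsin : ((@sin R : R -> R^o)^`())%classic = cos.
  by apply/funext => t; rewrite derive1E; apply: derive_val.
have csin := @continuous_sin R.
have ccos := @continuous_cos R.
have := @integration_by_substitution_increasing R sin half_width
  (- (pi / 2)) (pi / 2) (ltW pi0).
rewrite sinN sin_pihalf dsin => ->; first last.
- exact: continuous_subspaceT.
- split; first by move=> t _; exact: derivable_sin.
  + by apply: cvg_at_right_filter; exact: csin.
  + by apply: cvg_at_left_filter; exact: csin.
- by apply/cvg_ex; exists (cos (pi / 2)); apply: cvg_at_left_filter; exact: ccos.
- by apply/cvg_ex; exists (cos (- (pi / 2))); apply: cvg_at_right_filter; exact: ccos.
- by move=> t _; exact: ccos.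
- by move=> x y xI yI; rewrite ltr_sin.
rewrite (eq_integral (fun t : measurableTypeR R => (cos t ^+ 2 * 2)%:E)); last first.
  move=> t; rewrite inE/= in_itv/= => tI; congr (_%:E).
  rewrite mulrfctE /= /half_width -cos2sin2 sqrtr_sqr ger0_norm ?cos_ge0_pihalf//.
  by rewrite expr2; ring.
rewrite (@continuous_FTC2 R _ F) //.
- rewrite -EFinB /F sinN cosN cos_pihalf !mulr0 !addr0 opprK.
  by rewrite -splitr.
- apply: continuous_subspaceT => t.
  apply: (@cvgM _ _ _ _ (fun t : R => cos t ^+ 2) (cst 2));
    last exact: cvg_cst.
  by under eq_fun do rewrite expr2; rewrite expr2; apply: cvgM; exact: ccos.
- have dF t : derivable F t 1 by apply: ex_derive; exact: is_derive_F.
  have cF : continuous F.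
    by move=> t; apply/differentiable_continuous/derivable1_diffP/dF.
  split => //.
  + by apply: cvg_at_right_filter; exact: cF.
  + by apply: cvg_at_left_filter; exact: cF.
- by move=> t _; rewrite derive1E; apply: derive_val.
Qed.

Let norm_le1 (y c : R) : 0 <= c -> (y ^+ 2 <= c) = (`|y| <= Num.sqrt c).
Proof. by move=> c0; rewrite -sqrtr_sqr ler_sqrt. Qed.

Lemma lebesgue_unit_disc : (mu \x mu)%E (@unit_disc R) = (pi : R)%:E.
Proof.
rewrite /product_measure1 -integral_half_width [RHS]integral_mkcond.
apply: eq_integral => x _; rewrite patchE /=.
have xE : (x \in `[(-1)%R, 1%R]%classic) = (x ^+ 2 <= 1).
  by rewrite norm_le1// sqrtr1 ler_norml mem_setE in_itv.
rewrite xE; case: ifPn => x1.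
  have x1' : 0 <= 1 - x ^+ 2 by rewrite subr_ge0.
  rewrite (_ : xsection _ _ =
    `[- Num.sqrt (1 - x ^+ 2), Num.sqrt (1 - x ^+ 2)]%classic); last first.
    have yE y : (y \in `[- Num.sqrt (1 - x ^+ 2), Num.sqrt (1 - x ^+ 2)]) =
        (x ^+ 2 + y ^+ 2 <= 1).
      by rewrite in_itv/= -ler_norml -norm_le1// lerBrDl.
    apply/seteqP; split => y /=.
      by rewrite yE => /xsectionP.
    by move=> yI; apply/xsectionP; rewrite /unit_disc /= -yE.
  rewrite lebesgue_measure_itv/= lte_fin; case: ifPn => [_|].
    by rewrite -EFinB opprK /half_width mulr_natr mulr2n.
  rewrite -leNgt => h; have := sqrtr_ge0 (1 - x ^+ 2) => s0.
  by rewrite /half_width (_ : Num.sqrt (1 - x ^+ 2) = 0) ?mul0r//; lra.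
rewrite (_ : xsection _ _ = set0) ?measure0//.
apply/seteqP; split => y // /xsectionP/= h; apply: (negP x1).
by apply: le_trans h; rewrite lerDl sqr_ge0.
Qed.

Let pdf_ge0 x : 0 <= uniform_disc_pdf x.
Proof. by rewrite mulr_ge0// invr_ge0 pi_ge0. Qed.

Lemma measurable_uniform_disc_pdf : measurable_fun setT uniform_disc_pdf.
Proof.
apply: measurable_funM => //; apply: measurable_indic.
exact: measurable_unit_disc.
Qed.

Let uniform_disc0 : uniform_disc set0 = 0%E.
Proof. by rewrite /uniform_disc integral_set0. Qed.

Let uniform_disc_ge0 A : (0 <= uniform_disc A)%E.
Proof. by apply: integral_ge0 => /= x _; rewrite lee_fin pdf_ge0. Qed.

Let uniform_disc_sigma_additive : semi_sigma_additive uniform_disc.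
Proof.
move=> /= A mA tA mUA; rewrite /uniform_disc; apply: cvg_toP.
  apply: ereal_nondecreasing_is_cvgn => m n mn.
  apply: lee_sum_nneg_natr => // k _ _.
  by apply: integral_ge0 => /= x _; rewrite lee_fin pdf_ge0.
rewrite ge0_integral_bigcup//=.
- apply: measurable_funTS; apply: measurableT_comp => //.
  exact: measurable_uniform_disc_pdf.
- by move=> x _; rewrite lee_fin pdf_ge0.
Qed.

HB.instance Definition _ := isMeasure.Build _ _ _ uniform_disc
  uniform_disc0 uniform_disc_ge0 uniform_disc_sigma_additive.

Let uniform_disc_setT : uniform_disc [set: _] = 1%E.
Proof.
rewrite /uniform_disc /uniform_disc_pdf.
under eq_integral do rewrite EFinM.
have mD := measurable_unit_disc.
rewrite ge0_integralZl//; last 2 first.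
- by apply/measurable_EFinP; exact: measurable_indic.
- by rewrite lee_fin invr_ge0 pi_ge0.
rewrite integral_indic// setIT; have := lebesgue_unit_disc => /= ->.
by rewrite -EFinM mulVf// gt_eqF// pi_gt0.
Qed.

HB.instance Definition _ := @Measure_isProbability.Build _ _ R
  uniform_disc uniform_disc_setT.

End uniform_disc.

Arguments uniform_disc : clear implicits.

(* Main.v *)
(* In polar sectors everything is explicit.  Rotations are products of shears, so
   they preserve planar Lebesgue measure; hence for a configuration invariant
   under the rotation of angle 2 pi / n, the distortion is n / pi times an
   integral over a single sector of the disc.  With
   M n = 2 n sin (pi / n) / (3 pi), the regular n-gon of radius r has distortion
   1 / 2 + r ^ 2 - 2 r M n, minimal exactly at r = M n, whatever the phase.  For
   the origin and a square of radius r <= 1 the distortion is at least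
   1 / 2 + r ^ 2 - 2 r M 4 - r ^ 4 / (3 pi), which exceeds 1 / 2 - M 5 ^ 2.  An
   optimal set exists because clamping the coordinates of the points to [-1, 1]
   does not increase the distortion, which is continuous on the resulting box. *)
Require Import Defs.
From HB Require Import structures.
From mathcomp Require Import all_boot all_order all_algebra.
From mathcomp Require Import ring lra.
From mathcomp Require Import all_classical all_reals all_analysis.
From mathcomp Require Import measurable_realfun.
Set Implicit Arguments.
Unset Strict Implicit.
Unset Printing Implicit Defensive.
Import Order.TTheory GRing.Theory Num.Theory.
Import numFieldNormedType.Exports.
Local Open Scope classical_set_scope.
Local Open Scope ring_scope.

(** * Invariance of planar Lebesgue measure under rotations *)

(** No change to polar coordinates takes place. Planar measure is a product measure, accessible
    through slices, and a shear merely translates each slice; hence the detour through shears. A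
    sector is a cone given by an explicit inequality, and equally the set of points whose dot
    product with one of [n] equally spaced directions is largest, that is, the cell of one vertex of
    the polygon; the second form gives the symmetry, the first the slices. [M n] is the abscissa of
    the centroid of a sector of the disc, so the optimal radius places each vertex at the centroid
    of its cell. The term in [r ^ 4] bounds what the origin saves over the vertices of the square.
    Integrals are only added for nonnegative functions, so identities with a minus sign are proved
    with that term moved across. Existence of an optimal set is essential: the assumed shape
    concerns optimal sets alone, and would say nothing about the infimum if there were none. *)

Lemma ge0_integral_measure_preserving d (T : measurableType d) (R : realType)
    (m : {measure set T -> \bar R}) (phi : T -> T) (D : set T)
    (f : T -> \bar R) :
  measurable_fun setT phi ->
  (forall A, measurable A -> m (phi @^-1` A) = m A) ->
  measurable D -> measurable_fun setT f -> (forall x, 0 <= f x)%E ->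
  (\int[m]_(x in phi @^-1` D) f (phi x) = \int[m]_(x in D) f x)%E.
Proof.
move=> mphi inv mD mf f0.
rewrite -[LHS](ge0_integral_pushforward mphi)//; last exact: measurable_funTS.
by apply: eq_measure_integral => A mA _; exact: inv.
Qed.

Section rotation.
Context {R : realType}.
Local Notation mu := (@lebesgue_measure R).
Local Notation mu2 := (mu \x mu)%E.

Lemma lebesgue_measure_translation (c : R) (A : set R) : measurable A ->
  mu ((fun x => x + c) @^-1` A) = mu A.
Proof.
move=> mA; apply/esym.
have mt : measurable_fun setT (fun x : R => x + c : measurableTypeR R).
  exact: measurable_funD.
pose m := pushforward mu (fun x : R => x + c : measurableTypeR R).
have mE : forall X, measurable X -> mu X = m X.
  apply: lebesgue_measure_unique => //= _ [[a b]] _ <-.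
  rewrite /m /pushforward.
  rewrite (_ : _ @^-1` _ = `]a - c, b - c]%classic); last first.
    by apply/seteqP; split => x /=; rewrite !in_itv/= ltrBlDr lerBrDr.
  rewrite !lebesgue_measure_itv/= !lte_fin ltrD2r -!EFinB.
  by case: ifP => // _; congr EFin; ring.
exact: mE.
Qed.

Lemma product_measure21 (A : set (R * R)) : measurable A ->
  mu2 A = (mu \x^ mu)%E A.
Proof.
move=> mA; apply: product_measure_unique => // B C mB mC.
exact: product_measure2E.
Qed.

Lemma measurable_affine (a b : R) :
  measurable_fun setT (fun x : R * R => a * x.1 + b * x.2).
Proof.
by apply: measurable_funD; apply: measurable_funM.
Qed.

Lemma measurable_linear2 (a b c d : R) :
  measurable_fun setT (fun x : R * R => (a * x.1 + b * x.2, c * x.1 + d * x.2)).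
Proof.
by apply/measurable_fun_pairP; split; exact: measurable_affine.
Qed.

Definition lin2 (a b c d : R) (x : R * R) : R * R :=
  (a * x.1 + b * x.2, c * x.1 + d * x.2).

Lemma measurable_preimage_lin2 a b c d (A : set (R * R)) :
  measurable A -> measurable (lin2 a b c d @^-1` A).
Proof.
by move=> mA; rewrite -[X in measurable X]setTI; exact: measurable_linear2.
Qed.

(** On the vertical line at abscissa [x] the shear is the translation by [k * x]. *)
Lemma lebesgue2_vshear (k : R) (A : set (R * R)) : measurable A ->
  mu2 (lin2 1 0 k 1 @^-1` A) = mu2 A.
Proof.
move=> mA; rewrite /product_measure1; apply: eq_integral => x _ /=.
rewrite -[RHS](lebesgue_measure_translation (k * x)); last first.
  exact: measurable_xsection.
congr (mu _); apply/seteqP; split => y; rewrite /xsection /lin2/= !inE/=;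
  by rewrite !mul1r mul0r addr0 addrC.
Qed.

(** Here the horizontal slices are translated, so the product measure is first rewritten with the
    second coordinate outermost. *)
Lemma lebesgue2_hshear (k : R) (A : set (R * R)) : measurable A ->
  mu2 (lin2 1 k 0 1 @^-1` A) = mu2 A.
Proof.
move=> mA; rewrite !product_measure21//; last exact: measurable_preimage_lin2.
rewrite /product_measure2; apply: eq_integral => x _ /=.
rewrite -[RHS](lebesgue_measure_translation (k * x)); last first.
  exact: measurable_ysection.
congr (mu _); apply/seteqP; split => y; rewrite /ysection /lin2/= !inE/=;
  by rewrite !mul1r mul0r add0r.
Qed.

Definition rotate (t : R) : R * R -> R * R :=
  lin2 (cos t) (- sin t) (sin t) (cos t).

Lemma rotateD s t x : rotate (s + t) x = rotate s (rotate t x).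
Proof. by rewrite /rotate /lin2/= cosD sinD; congr pair; ring. Qed.

(* A rotation of angle different from pi is a product of three shears. *)
Lemma lebesgue2_rotate (t : R) (A : set (R * R)) : measurable A ->
  mu2 (rotate t @^-1` A) = mu2 A.
Proof.
have shears u B : 1 + cos u != 0 -> measurable B ->
    mu2 (rotate u @^-1` B) = mu2 B.
  (* This [k] is [- tan (u / 2)], the horizontal coefficient in the classical factorization of a
     rotation into three shears. *)
  move=> cu mB; pose k := - sin u / (1 + cos u).
  have ks : 1 + sin u * k = cos u.
    apply: (mulfI cu); rewrite /k mulrDr mulr1 mulrCA.
    have -> : (1 + cos u) * (- sin u / (1 + cos u)) = - sin u by field.
    by rewrite mulrN -expr2 sin2cos2; ring.
  have kc : k + k * cos u = - sin u by rewrite /k; field.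
  have rotateE : rotate u = lin2 1 k 0 1 \o (lin2 1 0 (sin u) 1 \o lin2 1 k 0 1).
    apply/funext => x; rewrite /rotate /lin2/= !mul1r !mul0r !add0r ?addr0.
    have -> : sin u * (x.1 + k * x.2) + x.2 = sin u * x.1 + cos u * x.2.
      by rewrite -ks; ring.
    by congr pair; rewrite -kc -[X in X * x.1]ks; ring.
  have mB1 : measurable (lin2 1 k 0 1 @^-1` B).
    exact: measurable_preimage_lin2.
  have mB2 : measurable (lin2 1 0 (sin u) 1 @^-1` (lin2 1 k 0 1 @^-1` B)).
    exact: measurable_preimage_lin2.
  rewrite rotateE; apply: etrans (lebesgue2_hshear k mB).
  apply: etrans (lebesgue2_vshear (sin u) mB1).
  exact: (lebesgue2_hshear k mB2).
move=> mA; have [c|] := eqVneq (1 + cos t) 0; last by move=> c; exact: shears.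
(* When [cos t = -1] the factorization breaks down, but it applies to [t / 2], and the rotation is
   done twice. *)
have c2 : cos (t / 2) = 0.
  have : cos (t / 2 + t / 2) = -1 by rewrite -splitr; lra.
  rewrite cosD -!expr2 sin2cos2 => h; apply/eqP; rewrite -sqrf_eq0; lra.
have c1 : 1 + cos (t / 2) != 0 by rewrite c2 addr0 oner_neq0.
have rotateE : rotate t = rotate (t / 2) \o rotate (t / 2).
  by apply/funext => x /=; rewrite -rotateD -splitr.
have mB : measurable (rotate (t / 2) @^-1` A).
  exact: measurable_preimage_lin2.
by rewrite rotateE; apply: etrans (shears _ _ c1 mB) (shears _ _ c1 mA).
Qed.

Lemma measurable_rotate t : measurable_fun setT (rotate t).
Proof. exact: measurable_linear2. Qed.

Lemma ge0_integral_rotate (t : R) (D : set (R * R)) (f : R * R -> \bar R) :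
  measurable D -> measurable_fun setT f -> (forall x, 0 <= f x)%E ->
  (\int[mu2]_(x in rotate t @^-1` D) f (rotate t x) = \int[mu2]_(x in D) f x)%E.
Proof.
move=> mD mf f0.
have mr : @measurable_fun _ _ (measurableTypeR R * measurableTypeR R)%type
    (measurableTypeR R * measurableTypeR R)%type setT (rotate t).
  exact: measurable_rotate.
exact: (ge0_integral_measure_preserving mr (lebesgue2_rotate t) mD mf f0).
Qed.

End rotation.

(** * Sectors *)

(** Adjacent sectors share a boundary ray, so they form a partition only off a null set [N]; there
    the indicators of the [S k] sum to 1. *)
Lemma ge0_integral_ae_partition d (T : measurableType d) (R : realType)
    (m : {measure set T -> \bar R}) (n : nat) (S : nat -> set T) (D N : set T)
    (f : T -> \bar R) :
  measurable D -> (forall k, measurable (S k)) ->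
  measurable_fun setT f -> (forall x, 0 <= f x)%E ->
  m.-negligible N ->
  (forall x, ~ N x -> exists2 k, (k < n)%N & S k x) ->
  (forall x, ~ N x -> forall j k, (j < k < n)%N -> S j x -> S k x -> False) ->
  (\int[m]_(x in D) f x =
   \sum_(k < n) \int[m]_(x in D) ((\1_(S k) x)%:E * f x))%E.
Proof.
move=> mD mS mf f0 nN cov disj.
have mg k : measurable_fun setT (fun x => (\1_(S k) x)%:E * f x)%E.
  apply: emeasurable_funM => //; apply/measurable_EFinP.
  exact: measurable_indic.
have g0 k x : (0 <= (\1_(S k) x)%:E * f x)%E.
  by rewrite mule_ge0// lee_fin.
rewrite -(@ge0_integral_sum _ _ _ m D mD 'I_n
  (fun (k : 'I_n) x => (\1_(S k) x)%:E * f x)%E)//; last first.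
  by move=> k; exact: measurable_funTS.
apply: ge0_ae_eq_integral => //.
- exact: measurable_funTS.
- by apply: emeasurable_sum => k; exact: measurable_funTS.
- by move=> x _; exact: sume_ge0.
case: nN => B [mB B0 NB]; exists B; split => //.
apply: subset_trans NB => x /= h; apply: contrapT => Nx; apply: h => _.
have [k kn Skx] := cov x Nx.
rewrite (bigD1 (Ordinal kn))//= indicE mem_set// mul1e big1 ?adde0// => i ik.
rewrite indicE memNset ?mul0e// => Six.
have [ltik|ltki|eik] := ltngtP i k.
- by apply: (disj x Nx i k) => //; rewrite ltik.
- by apply: (disj x Nx k i) => //; rewrite ltki ltn_ord.
- by move/eqP : ik; apply; apply/val_inj.
Qed.

Lemma ge0_integral_indicMl d (T : measurableType d) (R : realType)
    (m : {measure set T -> \bar R}) (S D : set T) (f : T -> \bar R) :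
  measurable D -> measurable S ->
  (\int[m]_(x in D) ((\1_S x)%:E * f x) = \int[m]_(x in D `&` S) f x)%E.
Proof.
move=> mD mS; rewrite integral_mkcondr; apply: eq_integral => x _.
by rewrite patchE indicE; case: (x \in S); rewrite ?mul1e ?mul0e.
Qed.

Section sectors.
Context {R : realType}.
Local Notation mu := (@lebesgue_measure R).
Local Notation mu2 := (mu \x mu)%E.
Implicit Types (x y : R * R) (n j k : nat).

Definition dot x y : R := x.1 * y.1 + x.2 * y.2.

Definition dir (t : R) : R * R := (cos t, sin t).

Definition angle n k : R := 2 * pi * k%:R / n%:R.

Lemma dot_rotate t x y : dot (rotate t x) (rotate t y) = dot x y.
Proof.
rewrite /dot /rotate /lin2/= -[RHS]mulr1 -(cos2Dsin2 t); ring.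
Qed.

Lemma rotate0 x : rotate 0 x = x.
Proof.
by rewrite /rotate /lin2 cos0 sin0 oppr0 !mul1r !mul0r addr0 add0r; case: x.
Qed.

Lemma rotateK t x : rotate t (rotate (- t) x) = x.
Proof. by rewrite -rotateD subrr rotate0. Qed.

Lemma rotate_dir s t : rotate s (dir t) = dir (s + t).
Proof. by rewrite /rotate /lin2 /dir/= cosD sinD; congr pair; ring. Qed.

Lemma unit_disc_rotate t : rotate t @^-1` unit_disc = @unit_disc R.
Proof.
apply/seteqP; suff E x :
    (rotate t x).1 ^+ 2 + (rotate t x).2 ^+ 2 = x.1 ^+ 2 + x.2 ^+ 2.
  by split=> x; rewrite /unit_disc/= E.
by have := dot_rotate t x x; rewrite /dot -!expr2.
Qed.

Lemma angleD n j k : angle n (j + k) = angle n j + angle n k.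
Proof. by rewrite /angle natrD mulrDr mulrDl. Qed.

Lemma angleS n k : angle n k.+1 = angle n 1 + angle n k.
Proof. by rewrite -angleD. Qed.

Lemma angle0 n : angle n 0 = 0.
Proof. by rewrite /angle mulr0 mul0r. Qed.

Lemma angle_half n k : angle n k = (pi * k%:R / n%:R) *+ 2.
Proof. by rewrite /angle -mulr_natl; ring. Qed.

Lemma dirD2pi (t : R) : dir (t + pi *+ 2) = dir t.
Proof. by rewrite /dir cosD2pi sinD2pi. Qed.

Lemma dirD2piMn (t : R) m : dir (t + pi *+ 2 *+ m) = dir t.
Proof.
elim: m => [|m ih]; first by rewrite mulr0n addr0.
by rewrite mulrS addrA addrAC dirD2pi.
Qed.

Lemma angle_full n m : (0 < n)%N -> angle n (m * n) = pi *+ 2 *+ m.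
Proof.
move=> n0; rewrite /angle natrM -[in RHS]mulr_natr -mulr_natl.
by field; rewrite pnatr_eq0 -lt0n.
Qed.

Lemma dir_angle_modn n k : (0 < n)%N -> dir (angle n (k %% n)) = dir (angle n k).
Proof.
move=> n0; rewrite [in RHS](divn_eq k n) addnC angleD angle_full//.
by rewrite dirD2piMn.
Qed.

(* The points whose argument lies in [-pi/n, pi/n], for n > 2. *)
Definition sector n : set (R * R) :=
  [set x | `|x.2| * cos (pi / n%:R) <= x.1 * sin (pi / n%:R)].

Lemma measurable_sector n : measurable (sector n).
Proof.
have mf : measurable_fun [set: R * R] (fun x : R * R =>
    `|x.2| * cos (pi / n%:R) - x.1 * sin (pi / n%:R)).
  apply: measurable_funB; apply: measurable_funM => //.
  exact: measurableT_comp.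
rewrite (_ : sector n = setT `&` (fun x : R * R =>
    `|x.2| * cos (pi / n%:R) - x.1 * sin (pi / n%:R)) @^-1` `]-oo, 0%R]); last first.
  by apply/seteqP; split => x /=; rewrite in_itv/= subr_le0; [split|case].
exact: mf.
Qed.

Section fixed_n.
Variable n : nat.
Hypothesis n2 : (2 < n)%N.
Let b : R := pi / n%:R.

Let n0 : (0 < n%:R :> R).
Proof. by rewrite ltr0n (leq_trans _ n2). Qed.

Let b_gt0 : 0 < b.
Proof. by rewrite divr_gt0// pi_gt0. Qed.

Let b_lt : b < pi / 2.
Proof. by rewrite ltr_pM2l ?pi_gt0// ltf_pV2 ?posrE// ltr_nat. Qed.

Lemma sin_pidiv_gt0 : 0 < sin (pi / n%:R) :> R.
Proof. by rewrite sin_gt0_pihalf// b_gt0 b_lt. Qed.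

Lemma cos_pidiv_gt0 : 0 < cos (pi / n%:R) :> R.
Proof.
by rewrite cos_gt0_pihalf// b_lt (lt_trans _ b_gt0)// oppr_lt0 (lt_trans b_gt0).
Qed.

(** Half-angle factorization: comparing the directions of angles 0 and [2 a] amounts to finding the
    side of their bisector, the line of angle [a], on which [x] lies. *)
Lemma dot_dir_double x (a : R) :
  x.1 - dot x (dir (a *+ 2)) = 2 * sin a * (x.1 * sin a - x.2 * cos a).
Proof.
rewrite /dot /dir/= cos_mulr2n sin_mulr2n cos2sin2; ring.
Qed.

(** Identifies the cone with the cell of direction 0. Its two edges are the bisectors with the
    neighbouring directions; the remaining comparisons follow from these two. *)
Lemma sectorP x : sector n x <-> forall k, dot x (dir (angle n k)) <= x.1.
Proof.
have sb := sin_pidiv_gt0; have cb := cos_pidiv_gt0; split=> [Sx k|h].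
  have y0 : 0 <= `|x.2| by [].
  have n0' : (0 < n)%N by exact: leq_trans n2.
  rewrite -dir_angle_modn// -subr_ge0 angle_half dot_dir_double.
  case: (k %% n)%N (ltn_pmod k n0') => [_|j jn].
    by rewrite mulr0 mul0r sin0 mulr0 mul0r.
  (* The half-angle [a] of a direction other than 0 lies in [[b, pi - b]]. Then [sin (a - b)] and
     [sin (a + b)] are nonnegative, which means that the absolute value of [cos a * sin b] is at
     most [sin a * cos b]. *)
  set a := pi * _ / _.
  have ab : b <= a.
    by rewrite /a /b ler_pM2r ?invr_gt0// ler_peMr ?pi_ge0// ler1n.
  have apb : a <= pi - b.
    have piE : pi = b * n%:R by rewrite /b divfK// gt_eqF.
    have -> : a = b * j.+1%:R by rewrite /a /b mulrAC.
    by rewrite piE lerBrDr -{2}[b]mulr1 -mulrDr ler_pM2l// natr1 ler_nat.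
  have sa : 0 <= sin a by apply: sin_ge0_pi; have := b_gt0; lra.
  have s1 : 0 <= sin (a - b) by apply: sin_ge0_pi; have := b_gt0; lra.
  have s2 : 0 <= sin (a + b) by apply: sin_ge0_pi; have := b_gt0; lra.
  rewrite sinB in s1; rewrite sinD in s2.
  apply: mulr_ge0; first by rewrite mulr_ge0.
  rewrite subr_ge0 -(ler_pM2r sb).
  have hS : `|x.2| * cos b * sin a <= x.1 * sin b * sin a by rewrite ler_wpM2r.
  rewrite -/b in sb cb *.
  have : x.2 * (cos a * sin b) <= `|x.2| * (cos b * sin a).
    have := ler_norm x.2; have := ler_norm (- x.2); rewrite normrN => l1 l2.
    have [c0|/ltW c0] := leP 0 (cos a * sin b); first by nra.
    by nra.
  lra.
have h1 : 0 <= x.1 * sin b - x.2 * cos b.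
  have := h 1; rewrite -subr_ge0 angle_half mulr1 dot_dir_double.
  by rewrite pmulr_rge0// mulr_gt0.
have h2 : 0 <= x.1 * sin b + x.2 * cos b.
  (* The last direction is the other neighbour of direction 0: its angle is [- 2 b] up to a full
     turn. *)
  have := h n.-1.
  have -> : dir (angle n n.-1) = dir ((- b) *+ 2).
    rewrite -(dirD2pi (- b *+ 2)); congr dir.
    have E (p N : R) : N != 0 -> 2 * p * (N - 1) / N = - (p / N) *+ 2 + p *+ 2.
      by move=> N0; field.
    by rewrite /angle -subn1 natrB ?(leq_trans _ n2)// E// gt_eqF.
  rewrite -subr_ge0 dot_dir_double sinN cosN => h2; rewrite -(pmulr_rge0 _ sb); lra.
rewrite /sector/= -/b; have [x0|x0] := leP 0 x.2.
  by rewrite ger0_norm//; lra.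
by rewrite ltr0_norm//; lra.
Qed.

(** In this symmetric form the rotated sectors visibly cover the plane, since some direction attains
    the maximum, and overlap only where two directions tie. *)
Lemma sector_rotateP x k : sector n (rotate (- angle n k) x) <->
  forall j, dot x (dir (angle n j)) <= dot x (dir (angle n k)).
Proof.
have n0' : (0 < n)%N by exact: leq_trans n2.
have E j : dot (rotate (- angle n k) x) (dir (angle n j)) =
    dot x (dir (angle n (j + k))).
  by rewrite -(dot_rotate (angle n k)) rotateK rotate_dir angleD addrC.
have -> : sector n (rotate (- angle n k) x) <->
    forall j, dot x (dir (angle n (j + k))) <= dot x (dir (angle n k)).
  have E0 : (rotate (- angle n k) x).1 = dot x (dir (angle n k)).
    have := E 0%N; rewrite angle0 add0n => <-.
    by rewrite /dot /dir cos0 sin0/= mulr1 mulr0 addr0.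
  by rewrite sectorP E0; split => h j; have := h j; rewrite E.
(* The index [j + (k * n - k)] stands for [j - k] modulo [n], avoiding a truncated subtraction. *)
split => h j //; have := h (j + (k * n - k))%N.
rewrite -addnA subnK; last by rewrite leq_pmulr.
by rewrite angleD angle_full// dirD2piMn.
Qed.

Lemma sector_cover x : exists2 k, (k < n)%N & sector n (rotate (- angle n k) x).
Proof.
have n0' : (0 < n)%N by exact: leq_trans n2.
pose F (i : 'I_n) := dot x (dir (angle n i)).
case: (@arg_maxP _ _ _ (Ordinal n0') xpredT F erefl) => i _ Fi.
exists i => //; apply/sector_rotateP => j; rewrite -(dir_angle_modn j)//.
by have := Fi (Ordinal (ltn_pmod j n0')) erefl.
Qed.

(** Needed so that a tie between two directions is a genuine line, hence null. Half the difference
    of the angles lies strictly between 0 and pi, so its sine cannot vanish. *)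
Lemma dir_angle_inj j k : (j < k < n)%N -> dir (angle n j) <> dir (angle n k).
Proof.
move=> /andP[jk kn] [ec es].
pose g : R := pi * (k - j)%:R / n%:R.
have : cos (angle n k - angle n j) = 1.
  by rewrite cosB ec es -!expr2 cos2Dsin2.
have -> : angle n k - angle n j = g *+ 2.
  by rewrite -{1}(subnK (ltnW jk)) angleD addrK angle_half.
have sg : 0 < sin g.
  apply: sin_gt0_pi; apply/andP; split.
    by rewrite /g !mulr_gt0 ?pi_gt0 ?invr_gt0// ltr0n subn_gt0.
  rewrite /g -mulrA gtr_pMr ?pi_gt0// ltr_pdivrMr// mul1r ltr_nat.
  by rewrite (leq_ltn_trans _ kn)// leq_subr.
rewrite cos_mulr2n cos2sin2 => h; have : 0 < sin g ^+ 2 by rewrite exprn_gt0.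
lra.
Qed.

End fixed_n.

Lemma lebesgue2_line0 (p q : R) : (p, q) <> (0, 0) ->
  mu2 [set x | p * x.1 + q * x.2 = 0] = 0%E.
Proof.
move=> pq; have [q0|q0] := eqVneq q 0; last first.
  rewrite /product_measure1 integral0_eq// => x _ /=.
  rewrite (_ : xsection _ _ = [set - p * x / q]) ?lebesgue_measure_set1//.
  apply/seteqP; split => y /=.
    move=> /xsectionP/= h; apply: (mulIf q0); rewrite divfK//.
    by rewrite mulrC; lra.
  by move=> ->; apply/xsectionP => /=; field.
have p0 : p != 0 by apply/eqP => p0; apply: pq; rewrite p0 q0.
rewrite (_ : [set x | _] = [set 0] `*` setT); last first.
  apply/seteqP; split => x /=; rewrite q0 mul0r addr0.
    by move=> /eqP; rewrite mulf_eq0 (negPf p0) => /eqP.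
  by move=> [-> _]; rewrite mulr0.
by rewrite product_measure1E//= lebesgue_measure_set1 mul0e.
Qed.

Lemma negligible_line (p q : R) : (p, q) <> (0, 0) ->
  mu2.-negligible [set x | p * x.1 + q * x.2 = 0].
Proof.
move=> pq; apply/negligibleP; last exact: lebesgue2_line0.
rewrite -[X in measurable X]setTI.
have mf := @measurable_affine R p q.
rewrite (_ : [set x | _] = (fun x => p * x.1 + q * x.2) @^-1` [set 0])//.
by apply: mf.
Qed.

Lemma integral_sector n (D : set (R * R)) (f : R * R -> \bar R) :
  (2 < n)%N -> measurable D -> (forall t, rotate t @^-1` D = D) ->
  measurable_fun setT f -> (forall x, 0 <= f x)%E ->
  (forall x, f (rotate (angle n 1) x) = f x) ->
  (\int[mu2]_(x in D) f x = n%:R%:E * \int[mu2]_(x in D `&` sector n) f x)%E.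
Proof.
move=> n2 mD rD mf f0 fr.
have fr' k x : f (rotate (- angle n k) x) = f x.
  rewrite -[in RHS](rotateK (angle n k) x).
  elim: k (rotate _ x) => [|k ih] y; first by rewrite angle0 rotate0.
  by rewrite angleS rotateD fr ih.
pose S k : set (R * R) := rotate (- angle n k) @^-1` sector n.
(* The tie set of directions [j] and [k]. The bounds on the indices are part of the set, so that the
   union runs over all pairs of naturals and countable subadditivity applies. *)
pose F j k : set (R * R) := [set x | (j < k < n)%N /\
  dot x (dir (angle n j)) = dot x (dir (angle n k))].
have mS k : measurable (S k).
  by apply: measurable_preimage_lin2; exact: measurable_sector.
have nN : mu2.-negligible (\bigcup_j \bigcup_k F j k).
  apply: negligible_bigcup => j; apply: negligible_bigcup => k.
  have [jkn|jkn] := boolP (j < k < n)%N; last first.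
    rewrite (_ : F j k = set0); first exact: negligible_set0.
    by apply/seteqP; split => x []; rewrite (negPf jkn).
  have pq : (cos (angle n j) - cos (angle n k),
      sin (angle n j) - sin (angle n k)) <> (0 : R, 0 : R).
    move=> [/eqP + /eqP]; rewrite !subr_eq0 => /eqP ec /eqP es.
    by apply: (dir_angle_inj n2 jkn); rewrite /dir ec es.
  apply: negligibleS (negligible_line pq) => x [_]; rewrite /dot/= => e.
  lra.
have cov x : ~ (\bigcup_j \bigcup_k F j k) x -> exists2 k, (k < n)%N & S k x.
  by move=> _; exact: sector_cover.
have disj x : ~ (\bigcup_j \bigcup_k F j k) x ->
    forall j k, (j < k < n)%N -> S j x -> S k x -> False.
  move=> Nx j k jk /(sector_rotateP n2) Sj /(sector_rotateP n2) Sk.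
  apply: Nx; exists j => //; exists k => //; split => //.
  by apply/eqP; rewrite eq_le Sk Sj.
transitivity (\sum_(k < n) \int[mu2]_(x in D) ((\1_(S k) x)%:E * f x))%E.
  exact: (@ge0_integral_ae_partition _ (measurableTypeR R * measurableTypeR R)%type
    R mu2 n S D _ f mD mS mf f0 nN cov disj).
pose g x := ((\1_(sector n) x)%:E * f x)%E.
have mg : measurable_fun setT g.
  apply: emeasurable_funM => //; apply/measurable_EFinP.
  by apply: measurable_indic; exact: measurable_sector.
have g0 x : (0 <= g x)%E by rewrite mule_ge0// lee_fin.
under eq_bigr => k _.
  rewrite (_ : integral _ _ _ = \int[mu2]_(x in D) g x)%E; last first.
    rewrite -(ge0_integral_rotate (- angle n k) mD mg g0) rD.
    by apply: eq_integral => x _; rewrite /g fr' !indicE /S !mem_setE.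
  over.
rewrite sumr_const card_ord mule_natl; congr (_ *+ _).
by apply: ge0_integral_indicMl => //; exact: measurable_sector.
Qed.

End sectors.

(** * Integrals over the disc and its sectors *)

Section sections.
Context d1 d2 (T1 : measurableType d1) (T2 : measurableType d2) (R : realType).
Variables (m1 : {sigma_finite_measure set T1 -> \bar R}).
Variables (m2 : {sigma_finite_measure set T2 -> \bar R}).

Lemma ge0_integral_xsection (G : set (T1 * T2)) (f : T1 * T2 -> \bar R) :
  measurable G -> measurable_fun setT f -> (forall x, 0 <= f x)%E ->
  (\int[m1 \x m2]_(z in G) f z =
   \int[m1]_x \int[m2]_(y in xsection G x) f (x, y))%E.
Proof.
move=> mG mf f0; rewrite integral_mkcond fubini_tonelli1.
- apply: eq_integral => x _; rewrite [RHS]integral_mkcond.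
  by apply: eq_integral => y _; rewrite !patchE mem_xsection.
- exact/(measurable_restrictT _ _).1/measurable_funTS.
- by move=> z; rewrite patchE; case: ifP.
Qed.

Lemma ge0_integral_ysection (G : set (T1 * T2)) (f : T1 * T2 -> \bar R) :
  measurable G -> measurable_fun setT f -> (forall x, 0 <= f x)%E ->
  (\int[m1 \x m2]_(z in G) f z =
   \int[m2]_y \int[m1]_(x in ysection G y) f (x, y))%E.
Proof.
move=> mG mf f0; rewrite integral_mkcond fubini_tonelli2.
- apply: eq_integral => x _; rewrite [RHS]integral_mkcond.
  by apply: eq_integral => y _; rewrite !patchE mem_ysection.
- exact/(measurable_restrictT _ _).1/measurable_funTS.
- by move=> z; rewrite patchE; case: ifP.
Qed.

End sections.

Section disc_integrals.
Context {R : realType}.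
Local Notation mu := (@lebesgue_measure R).
Local Notation mu2 := (mu \x mu)%E.

Lemma integral_primitive (F f : R -> R) (a b : R) : a <= b -> continuous f ->
  (forall x : R, is_derive x 1 F (f x)) ->
  (\int[mu]_(x in `[a, b]) (f x)%:E = (F b - F a)%:E)%E.
Proof.
rewrite le_eqVlt => /predU1P[<- _ _|ab cf dF].
  by rewrite set_itv1 integral_set1 subrr.
have dF' t : derivable F t 1 by apply: ex_derive; exact: dF.
have cF : continuous F.
  by move=> t; apply/differentiable_continuous/derivable1_diffP/dF'.
rewrite (@continuous_FTC2 R f F) ?EFinB//.
- exact: continuous_subspaceT.
- split => //.
  + by apply: cvg_at_right_filter; exact: cF.
  + by apply: cvg_at_left_filter; exact: cF.
- by move=> t _; rewrite derive1E; apply: derive_val.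
Qed.

Lemma lebesgue_itvcc (a b : R) : a <= b -> mu `[a, b] = (b - a)%:E.
Proof.
move=> ab; rewrite lebesgue_measure_itv/= lte_fin.
case: ifPn; first by rewrite EFinB.
by rewrite -leNgt => ba; rewrite (_ : a = b) ?subrr//; apply/eqP; rewrite eq_le ab.
Qed.

Lemma xsection_unit_disc (t : R) : t ^+ 2 <= 1 ->
  xsection unit_disc t = `[- Num.sqrt (1 - t ^+ 2), Num.sqrt (1 - t ^+ 2)]%classic.
Proof.
move=> t1; have t1' : 0 <= 1 - t ^+ 2 by rewrite subr_ge0.
have yE y : (y \in `[- Num.sqrt (1 - t ^+ 2), Num.sqrt (1 - t ^+ 2)]) =
    (t ^+ 2 + y ^+ 2 <= 1).
  by rewrite in_itv/= -ler_norml -sqrtr_sqr ler_sqrt// lerBrDl.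
apply/seteqP; split => y /=; first by rewrite yE => /xsectionP.
by move=> yI; apply/xsectionP; rewrite /unit_disc /= -yE.
Qed.

Lemma sqr_le1_itv (t : R) : (t ^+ 2 <= 1) = (t \in `[(-1), 1]).
Proof.
by rewrite in_itv/= -ler_norml -(@real_normK _ t) ?num_real// expr_le1.
Qed.

Lemma integral_sqr_half_width :
  (\int[mu]_(x in `[(-1)%R, 1%R])
     (x ^+ 2 * (Num.sqrt (1 - x ^+ 2) *+ 2))%:E = (pi / 4 : R)%:E)%E.
Proof.
have pi0 : - (pi / 2) <= (pi / 2 : R) by rewrite ge0_cp// divr_ge0// pi_ge0.
have dsin : ((@sin R : R -> R^o)^`())%classic = cos.
  by apply/funext => t; rewrite derive1E; apply: derive_val.
have csin := @continuous_sin R.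
have ccos := @continuous_cos R.
pose G (x : R) : R := x ^+ 2 * (Num.sqrt (1 - x ^+ 2) *+ 2).
have cG : continuous G.
  move=> x; apply: cvgM; first exact: exprn_continuous.
  apply: cvgMn; apply: (@continuous_comp _ _ _ (fun x : R => 1 - x ^+ 2) Num.sqrt);
    last exact: sqrt_continuous.
  by apply: cvgB; [exact: cvg_cst|exact: exprn_continuous].
have := @integration_by_substitution_increasing R sin G
  (- (pi / 2)) (pi / 2) pi0.
rewrite sinN sin_pihalf dsin => ->; first last.
- exact: continuous_subspaceT.
- split; first by move=> t _; exact: derivable_sin.
  + by apply: cvg_at_right_filter; exact: csin.
  + by apply: cvg_at_left_filter; exact: csin.
- by apply/cvg_ex; exists (cos (pi / 2)); apply: cvg_at_left_filter; exact: ccos.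
- by apply/cvg_ex; exists (cos (- (pi / 2))); apply: cvg_at_right_filter; exact: ccos.
- by move=> t _; exact: ccos.
- by move=> x y xI yI; rewrite ltr_sin.
rewrite (eq_integral (fun t : measurableTypeR R =>
    (sin t ^+ 2 * cos t ^+ 2 * 2)%:E)); last first.
  move=> t; rewrite inE/= in_itv/= => tI; congr (_%:E).
  rewrite mulrfctE /= /G -cos2sin2 sqrtr_sqr ger0_norm ?cos_ge0_pihalf//.
  by rewrite -mulr_natr; ring.
(* This is [t / 4 - sin (4 t) / 16], since the integrand equals [(1 - cos (4 t)) / 4]. *)
pose F (t : R) : R := t / 4 - sin t * cos t * (1 - 2 * sin t ^+ 2) / 4.
have dF (t : R) : is_derive t 1 F (sin t ^+ 2 * cos t ^+ 2 * 2).
  rewrite /F; apply: is_derive_eq.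
  rewrite /GRing.scale/=.
  have := cos2Dsin2 t; set c := cos t; set s := sin t => cs.
  have E1 : c * c = 1 - s ^+ 2 by rewrite -cs; ring.
  have E2 : (s * s) * (c * c) = (s * s) * (1 - s ^+ 2) by rewrite E1.
  have E3 : (c * c) * (s * s) = (1 - s ^+ 2) * (s * s) by rewrite E1.
  by lra.
rewrite (integral_primitive pi0 _ dF)//.
  by rewrite /F sinN cosN cos_pihalf !mulr0 !mul0r !subr0; congr EFin; field.
move=> t; apply: cvgM; last exact: cvg_cst.
by rewrite /= !expr2; apply: cvgM; under eq_fun do rewrite expr2; apply: cvgM;
  (exact: csin || exact: ccos).
Qed.

Lemma integral_disc_sqr1 :
  (\int[mu2]_(x in unit_disc) (x.1 ^+ 2)%:E = (pi / 4 : R)%:E)%E.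
Proof.
rewrite ge0_integral_xsection//; last 3 first.
- exact: measurable_unit_disc.
- by apply/measurable_EFinP; apply: measurable_funX; exact: measurable_fst.
- by move=> x; rewrite lee_fin sqr_ge0.
rewrite -integral_sqr_half_width [RHS]integral_mkcond.
apply: eq_integral => t _; rewrite patchE/= mem_setE -sqr_le1_itv.
case: ifPn => t1.
  rewrite xsection_unit_disc// integral_cst//=.
  have s0 := sqrtr_ge0 (1 - t ^+ 2).
  rewrite lebesgue_itvcc ?ge0_cp// opprK -EFinM; congr EFin; ring.
rewrite (_ : xsection _ _ = set0) ?integral_set0//.
apply/seteqP; split => y // /xsectionP/= h; apply: (negP t1).
by apply: le_trans h; rewrite lerDl sqr_ge0.
Qed.

Lemma integral_disc_dot :
  (\int[mu2]_(x in unit_disc) (dot x x)%:E = (pi / 2 : R)%:E)%E.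
Proof.
have mD := @measurable_unit_disc R.
have m1 : measurable_fun [set: R * R] (fun x : R * R => (x.1 ^+ 2)%:E).
  by apply/measurable_EFinP; apply: measurable_funX; exact: measurable_fst.
have m2 : measurable_fun [set: R * R] (fun x : R * R => (x.2 ^+ 2)%:E).
  by apply/measurable_EFinP; apply: measurable_funX; exact: measurable_snd.
transitivity (\int[mu2]_(x in unit_disc) (x.1 ^+ 2)%:E +
              \int[mu2]_(x in unit_disc) (x.2 ^+ 2)%:E)%E.
  rewrite -ge0_integralD//.
  - by move=> x _; rewrite lee_fin sqr_ge0.
  - exact: measurable_funTS.
  - by move=> x _; rewrite lee_fin sqr_ge0.
  - exact: measurable_funTS.
suff -> : (\int[mu2]_(x in unit_disc) (x.2 ^+ 2)%:E =
    \int[mu2]_(x in unit_disc) (x.1 ^+ 2)%:E)%E.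
  by rewrite integral_disc_sqr1 -EFinD; congr EFin; field.
(* A quarter turn exchanges the squares of the two coordinates. *)
rewrite -(ge0_integral_rotate (pi / 2) mD m1); last first.
  by move=> x; rewrite lee_fin sqr_ge0.
rewrite unit_disc_rotate; apply: eq_integral => x _.
by rewrite /rotate /lin2/= cos_pihalf sin_pihalf mul0r add0r mulN1r sqrrN.
Qed.

Lemma integral_disc_cst (c : R) : 0 <= c ->
  (\int[mu2]_(x in unit_disc) c%:E = (c * pi)%:E)%E.
Proof.
move=> c0; rewrite integral_cst//; last exact: measurable_unit_disc.
by have := lebesgue_unit_disc R => /= ->.
Qed.

Lemma xsection_sector4 (t : R) :
  xsection (sector 4) t = `[- t, t]%classic.
Proof.
have e4 : cos (pi / 4) = sin (pi / 4) :> R.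
  have c0 : cos (pi / 4) != 0 :> R by rewrite gt_eqF// cos_pidiv_gt0.
  by have := @tan_piquarter R; rewrite /tan => /(canRL (divfK c0)); rewrite mul1r.
apply/seteqP; split => y.
  move=> /xsectionP; rewrite /sector/= e4 ler_pM2r ?sin_pidiv_gt0//.
  by rewrite in_itv/= ler_norml.
rewrite /= in_itv/= -ler_norml => h; apply/xsectionP.
by rewrite /sector/= e4 ler_pM2r ?sin_pidiv_gt0.
Qed.

(** The integrand is what the origin saves over the vertex [(r, 0)]: the squared distance to the
    vertex minus the one to the origin, where positive. It is supported on the triangle
    [x.1 <= r / 2] of the sector, so no disc is involved. *)
Lemma integral_sector4_maxr (r : R) : 0 < r ->
  (\int[mu2]_(x in sector 4) (Num.max 0 (r ^+ 2 - 2 * r * x.1))%:E =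
   (r ^+ 4 / 12)%:E)%E.
Proof.
move=> r0; rewrite ge0_integral_xsection//; last 3 first.
- exact: measurable_sector.
- apply/measurable_EFinP; apply: measurable_maxr => //.
  by apply: measurable_funB => //; apply: measurable_funM.
- by move=> x; rewrite lee_fin le_max lexx.
pose f (t : R) : R := 2 * r ^+ 2 * t - 4 * r * t ^+ 2.
pose F (t : R) : R := r ^+ 2 * t ^+ 2 - 4 / 3 * r * t ^+ 3.
have dF (t : R) : is_derive t 1 F (f t).
  by rewrite /F /f; apply: is_derive_eq; rewrite /GRing.scale/=; field.
transitivity (\int[mu]_(t in `[0%R, (r / 2)%R]) (f t)%:E)%E; last first.
  rewrite (@integral_primitive F f)//; first by congr EFin; rewrite /F; field.
  - by rewrite divr_ge0// ltW.
  - move=> t; rewrite /f; apply: cvgB; apply: cvgM;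
      (exact: cvg_cst || exact: cvg_id || exact: exprn_continuous).
rewrite [RHS]integral_mkcond; apply: eq_integral => t _.
rewrite patchE/= mem_setE in_itv/= xsection_sector4 integral_cst//=.
have [t0|t0] := leP 0 t; last first.
  rewrite set_itv_ge ?measure0 ?mule0// bnd_simp -ltNge; lra.
rewrite lebesgue_itvcc; last lra.
case: ifPn => /= tr.
  rewrite -EFinM max_r; last by nra.
  by congr EFin; rewrite /f; ring.
rewrite max_l ?mul0e//; move: tr; rewrite -ltNge => tr; nra.
Qed.

(** Horizontal slices run from the edge of the cone to the circle in a single regime, whereas
    vertical ones change shape at abscissa [cos (pi / n)]. *)
Lemma ysection_disc_sector n (t : R) : (2 < n)%N ->
  ysection (unit_disc `&` sector n) t =
  if `|t| <= sin (pi / n%:R) then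
    `[`|t| * (cos (pi / n%:R) / sin (pi / n%:R)), Num.sqrt (1 - t ^+ 2)]%classic
  else set0.
Proof.
move=> n2; have s0 : 0 < sin (pi / n%:R) :> R by exact: sin_pidiv_gt0.
have c0 : 0 < cos (pi / n%:R) :> R by exact: cos_pidiv_gt0.
have := cos2Dsin2 (pi / n%:R : R).
move: s0 c0; set s := sin _; set c := cos _ => s0 c0 cs.
have secE x : sector n (x, t) <-> `|t| * (c / s) <= x.
  by rewrite /sector/= -/s -/c mulrA ler_pdivrMr.
have discE x : 0 <= x -> t ^+ 2 <= 1 ->
    unit_disc (x, t) <-> x <= Num.sqrt (1 - t ^+ 2).
  move=> x0 t1; rewrite /unit_disc/= -lerBrDr -{2}(ger0_norm x0) -sqrtr_sqr.
  by rewrite ler_sqrt// subr_ge0.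
have tq0 : 0 <= `|t| * (c / s) by rewrite mulr_ge0// divr_ge0// ltW.
have s1 : s ^+ 2 <= 1 by have := sqr_ge0 c; lra.
apply/seteqP; split => x.
  move=> /ysectionP [Dx /secE Sx].
  have x0 : 0 <= x by exact: le_trans Sx.
  have ts : `|t| <= s.
    (* The cone gives [(u c)^2 <= (x s)^2] and the disc gives [x^2 <= 1 - u^2]; with [c^2 + s^2 = 1]
       these yield [u^2 <= s^2]. *)
    rewrite leNgt; apply/negP => st.
    have : `|t| * c <= x * s by move: Sx; rewrite mulrA ler_pdivrMr.
    have : x ^+ 2 + `|t| ^+ 2 <= 1 by rewrite real_normK ?num_real.
    have t0 : 0 <= `|t| by [].
    move: `|t| t0 st => u u0 su D S.
    have : (u * c) ^+ 2 <= (x * s) ^+ 2.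
      by rewrite ler_sqr ?nnegrE ?mulr_ge0// ltW.
    have : s ^+ 2 < u ^+ 2 by rewrite ltr_sqr ?nnegrE// ltW.
    rewrite !exprMn => A B; nra.
  rewrite ts /= in_itv/= Sx; apply/discE => //.
  rewrite -(@real_normK _ t) ?num_real//; apply: le_trans s1.
  by rewrite ler_sqr ?nnegrE// ltW.
case: ifPn => // ts; rewrite /= in_itv/= => /andP[Sx Dx]; apply/ysectionP.
split; last exact/secE.
apply/discE => //; first exact: le_trans Sx.
rewrite -(@real_normK _ t) ?num_real//; apply: le_trans s1.
by rewrite ler_sqr ?nnegrE// ltW.
Qed.

Lemma measurable_disc_sector n :
  measurable (unit_disc `&` sector n : set (R * R)).
Proof.
by apply: measurableI; [exact: measurable_unit_disc|exact: measurable_sector].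
Qed.

(** On the sector [x.1] is nonnegative; the absolute value extends this to the whole plane, as the
    slicing lemmas ask. The slice at height [t] contributes [((1 - t^2) - t^2 c^2 / s^2) / 2], which
    is [(1 - t^2 / s^2) / 2] because [c^2 + s^2 = 1]. *)
Lemma integral_disc_sector_abs1 n : (2 < n)%N ->
  (\int[mu2]_(x in unit_disc `&` sector n) `|x.1|%:E =
   (2 / 3 * sin (pi / n%:R))%:E)%E.
Proof.
move=> n2; have s0 : 0 < sin (pi / n%:R) :> R by exact: sin_pidiv_gt0.
have c0 : 0 < cos (pi / n%:R) :> R by exact: cos_pidiv_gt0.
have cs := cos2Dsin2 (pi / n%:R : R).
rewrite ge0_integral_ysection; last 3 first.
- exact: measurable_disc_sector.
- by apply/measurable_EFinP; apply: measurableT_comp => //; exact: measurable_fst.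
- by move=> x; rewrite lee_fin.
under eq_integral do rewrite ysection_disc_sector//.
move: s0 c0 cs; set s := sin _; set c := cos _ => s0 c0 cs.
pose f (t : R) : R := (1 - t ^+ 2 / s ^+ 2) / 2.
pose F (t : R) : R := t / 2 - t ^+ 3 / (6 * s ^+ 2).
have sN0 : s != 0 by rewrite gt_eqF.
have dF (t : R) : is_derive t 1 F (f t).
  rewrite /F /f; apply: is_derive_eq; rewrite /GRing.scale/=; field.
  by rewrite ?sN0.
transitivity (\int[mu]_(t in `[(- s)%R, s]) (f t)%:E)%E; last first.
  rewrite (@integral_primitive F f)//; first by congr EFin; rewrite /F; field.
  - by rewrite ge0_cp// ltW.
  - move=> t; rewrite /f; apply: cvgM; last exact: cvg_cst.
    apply: cvgB; first exact: cvg_cst.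
    by apply: cvgM; [exact: exprn_continuous|exact: cvg_cst].
rewrite [RHS]integral_mkcond; apply: eq_integral => t _.
rewrite patchE/= mem_setE in_itv/= -ler_norml.
case: ifPn => ts; last by rewrite integral_set0.
have q0 : 0 <= `|t| * (c / s) by rewrite mulr_ge0// divr_ge0// ltW.
have t1 : 0 <= 1 - t ^+ 2.
  have : `|t| ^+ 2 <= s ^+ 2 by rewrite ler_sqr ?nnegrE// ltW.
  by rewrite real_normK ?num_real//; have := sqr_ge0 c; lra.
pose G (x : R) : R := x ^+ 2 / 2.
have dG (x : R) : is_derive x 1 G x.
  by rewrite /G; apply: is_derive_eq; rewrite /GRing.scale/=; field.
have pq : `|t| * (c / s) <= Num.sqrt (1 - t ^+ 2).
  rewrite -(ger0_norm q0) -sqrtr_sqr ler_sqrt// exprMn real_normK ?num_real//.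
  have -> : (c / s) ^+ 2 = (s ^+ 2)^-1 - 1.
    have -> : (c / s) ^+ 2 = c ^+ 2 / s ^+ 2 by field.
    have -> : c ^+ 2 = 1 - s ^+ 2 by lra.
    by field.
  rewrite mulrBr mulr1 lerB// ler_pdivrMr ?exprn_gt0// mul1r.
  by rewrite -(@real_normK _ t) ?num_real// ler_sqr ?nnegrE// ltW.
transitivity (\int[mu]_(x in `[(`|t| * (c / s))%R, Num.sqrt (1 - t ^+ 2)]) x%:E)%E.
  apply: eq_integral => x; rewrite inE/= in_itv/= => /andP[qx _].
  by rewrite ger0_norm//; exact: le_trans qx.
rewrite (@integral_primitive G (fun x => x))//; last by move=> x; exact: cvg_id.
congr EFin; rewrite /G /f sqr_sqrtr// exprMn real_normK ?num_real//.
have -> : (c / s) ^+ 2 = c ^+ 2 / s ^+ 2 by field.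
have -> : c ^+ 2 = 1 - s ^+ 2 by lra.
by field.
Qed.

End disc_integrals.

(** * Distortion *)

Lemma ge0_integral_restr_scale d (T : measurableType d) (R : realType)
    (m m' : {measure set T -> \bar R}) (D : set T) (k : {nonneg R})
    (f : T -> \bar R) : measurable D ->
  (forall A, measurable A -> m' A = k%:num%:E * m (A `&` D))%E ->
  measurable_fun setT f -> (forall x, 0 <= f x)%E ->
  (\int[m']_x f x = k%:num%:E * \int[m]_(x in D) f x)%E.
Proof.
move=> mD m'E mf f0.
have mDC := measurableC mD.
have mfE E : measurable_fun E f by exact: measurable_funTS.
have DC : [disjoint ~` D & D] by apply/disj_set2P; rewrite setICl.
have m'0 : m' (~` D) = 0 by rewrite m'E// setICl measure0 mule0.
rewrite -(setvU D) ge0_integral_setU// null_set_integral// add0e.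
rewrite -ge0_integral_mscale//.
apply: eq_measure_integral => A mA AD.
by rewrite m'E// setIidl.
Qed.

Section distortion.
Context {R : realType}.
Local Notation mu := (@lebesgue_measure R).
Local Notation mu2 := (mu \x mu)%E.
Local Notation P := (uniform_disc R).
Implicit Types (x : R * R) (alpha : set (R * R)).

Definition mindist alpha x : \bar R :=
  ereal_inf [set (sqdist x a)%:E | a in alpha].

Lemma sqdist_ge0 x a : 0 <= sqdist x a.
Proof. by rewrite /sqdist addr_ge0// sqr_ge0. Qed.

Lemma mindist_ge0 alpha x : (0 <= mindist alpha x)%E.
Proof. by apply: le_ereal_inf_tmp => _ [a _ <-]; rewrite lee_fin sqdist_ge0. Qed.

Lemma measurable_sqdist (a : R * R) :
  measurable_fun setT (fun x => (sqdist x a)%:E).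
Proof.
by apply/measurable_EFinP; apply: measurable_funD; apply: measurable_funX;
  apply: measurable_funB.
Qed.

Lemma measurable_mindist_range (a : nat -> R * R) :
  measurable_fun setT (mindist (range a)).
Proof.
have := @measurable_fun_einfs _ _ R setT (fun n x => (sqdist x (a n))%:E)
  (fun n => measurable_sqdist (a n)) 0%N.
congr measurable_fun; apply/funext => x; rewrite /einfs /mindist; congr ereal_inf.
apply/seteqP; split => _ [k kP <-]; first by exists (a k) => //; exists k.
by case: kP => i _ <-; exists i.
Qed.

Lemma finite_range alpha n : alpha !=set0 -> (alpha #<= `I_n)%card ->
  exists a : nat -> R * R, alpha = a @` `I_n /\ alpha = range a.
Proof.
move=> [a0 aa0] /pcard_surjP[g gS].
pose a k := if g k \in alpha then g k else a0.
have aA k : alpha (a k) by rewrite /a; case: ifPn => // /set_mem.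
have alphaS : alpha `<=` a @` `I_n.
  move=> x ax; have [k kn gk] := gS x ax; exists k => //.
  by rewrite /a gk mem_set.
exists a; split; apply/seteqP; split => //.
- by move=> _ [k _ <-].
- by move=> x /alphaS[k _ <-]; exists k.
- by move=> _ [k _ <-].
Qed.

Lemma measurable_mindist alpha n : (alpha #<= `I_n)%card ->
  measurable_fun setT (mindist alpha).
Proof.
move=> an; have [->|/set0P a0] := eqVneq alpha set0.
  rewrite (_ : mindist set0 = cst +oo%E); first exact: measurable_cst.
  by apply/funext => x; rewrite /mindist image_set0 ereal_inf0.
by have [a [_ ->]] := finite_range a0 an; exact: measurable_mindist_range.
Qed.

Lemma integral_uniform_disc (f : R * R -> \bar R) :
  measurable_fun setT f -> (forall x, 0 <= f x)%E ->
  (\int[P]_x f x = pi^-1%:E * \int[mu2]_(x in unit_disc) f x)%E.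
Proof.
move=> mf f0; have p0 : 0 <= (pi : R)^-1 by rewrite invr_ge0 pi_ge0.
have PE A : measurable A ->
    (P A = (NngNum p0)%:num%:E * mu2 (A `&` unit_disc))%E.
  move=> mA; rewrite /uniform_disc /uniform_disc_pdf.
  under eq_integral do rewrite EFinM.
  have mD := @measurable_unit_disc R.
  rewrite ge0_integralZl; last 4 first.
  - exact: mA.
  - apply: measurable_funTS; apply/measurable_EFinP; exact: measurable_indic.
  - by move=> x _; rewrite lee_fin.
  - by rewrite lee_fin.
  by rewrite integral_indic// setIC.
(* P lives on the default measurable structure of R * R, mu2 on the product of
   measurableTypeR; pushing forward along the identity passes between them. *)
have mid : @measurable_fun _ _ (R * R)%type
    (measurableTypeR R * measurableTypeR R)%type setT id.
  exact: measurable_id.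
rewrite -[LHS](@ge0_integral_pushforward _ _ _ _ R _ mid P setT f)//.
apply: etrans.
  apply: (@ge0_integral_restr_scale _ (measurableTypeR R * measurableTypeR R)%type
    R mu2 _ unit_disc (NngNum p0) f (@measurable_unit_disc R) _ mf f0).
  exact: PE.
by [].
Qed.

Lemma distortionE alpha n : (alpha #<= `I_n)%card ->
  (distortion P alpha = pi^-1%:E * \int[mu2]_(x in unit_disc) mindist alpha x)%E.
Proof.
move=> an; apply: integral_uniform_disc; first exact: measurable_mindist an.
exact: mindist_ge0.
Qed.

Lemma sqdist_rotate t x a : sqdist (rotate t x) (rotate t a) = sqdist x a.
Proof.
have -> : sqdist (rotate t x) (rotate t a) =
    sqdist x a * (cos t ^+ 2 + sin t ^+ 2).
  by rewrite /sqdist /rotate /lin2/=; ring.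
by rewrite cos2Dsin2 mulr1.
Qed.

Lemma mindist_rotate t alpha x :
  mindist (rotate t @` alpha) (rotate t x) = mindist alpha x.
Proof.
rewrite /mindist; congr ereal_inf; apply/seteqP; split.
  by move=> _ [_ [a aa <-] <-]; exists a => //; rewrite sqdist_rotate.
by move=> _ [a aa <-]; exists (rotate t a); [exists a|rewrite sqdist_rotate].
Qed.

Lemma distortion_rotate t alpha n : (alpha #<= `I_n)%card ->
  distortion P (rotate t @` alpha) = distortion P alpha.
Proof.
move=> an; have an' : (rotate t @` alpha #<= `I_n)%card.
  exact: card_le_trans (card_image_le _ _) an.
rewrite (distortionE an) (distortionE an'); congr (_ * _)%E.
rewrite -[in LHS](ge0_integral_rotate t (@measurable_unit_disc R)
  (measurable_mindist an') (@mindist_ge0 _)).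
by rewrite unit_disc_rotate; apply: eq_integral => x _; exact: mindist_rotate.
Qed.

(** Convertible to the set in [regular_polygon0], so the two are interchanged without proof. *)
Definition polygon (n : nat) (r t : R) : set (R * R) :=
  [set (r * cos (t + angle n k), r * sin (t + angle n k)) | k in `I_n].

Lemma polygon_rotate n r t : polygon n r t = rotate t @` polygon n r 0.
Proof.
have E k : rotate t (r * cos (0 + angle n k), r * sin (0 + angle n k)) =
    (r * cos (t + angle n k), r * sin (t + angle n k)).
  by rewrite /rotate /lin2/= cosD sinD add0r; congr pair; ring.
apply/seteqP; split.
  move=> _ [k kn <-].
  by exists (r * cos (0 + angle n k), r * sin (0 + angle n k)); [exists k|].
by move=> _ [_ [k kn <-] <-]; exists k.
Qed.

Lemma polygon_card n r t : (polygon n r t #<= `I_n)%card.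
Proof. exact: card_image_le. Qed.

Lemma polygon_rotate_angle n r : (0 < n)%N ->
  rotate (angle n 1) @` polygon n r 0 = polygon n r 0.
Proof.
move=> n0; rewrite -polygon_rotate.
have modE k : (r * cos (angle n (k %% n)), r * sin (angle n (k %% n))) =
    (r * cos (angle n k), r * sin (angle n k)).
  by have [-> ->] := @dir_angle_modn R n k n0.
apply/seteqP; split => _ [k /= kn <-].
  exists (k.+1 %% n)%N; first exact: ltn_pmod.
  by rewrite add0r modE angleS.
exists ((k + n.-1) %% n)%N; first exact: ltn_pmod.
rewrite -angleS add0r -(modE (_.+1)) -addn1 modnDml addn1 -addnS prednK//.
by rewrite modnDr modE.
Qed.

Lemma sqdist_polar x (r t : R) :
  sqdist x (r * cos t, r * sin t) = dot x x + r ^+ 2 - 2 * r * dot x (dir t).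
Proof.
have -> : sqdist x (r * cos t, r * sin t) =
    dot x x + r ^+ 2 * (cos t ^+ 2 + sin t ^+ 2) - 2 * r * dot x (dir t).
  by rewrite /sqdist /dot /dir/=; ring.
by rewrite cos2Dsin2 mulr1.
Qed.

(** By [sqdist_polar], among vertices at the same radius the nearest is the one with the largest dot
    product, and [sectorP] names it. *)
Lemma mindist_polygon_sector n r x : (2 < n)%N -> 0 <= r -> sector n x ->
  mindist (polygon n r 0) x = (dot x x + r ^+ 2 - 2 * r * x.1)%:E.
Proof.
move=> n2 r0 /(sectorP n2) Sx; apply/eqP; rewrite eq_le; apply/andP; split.
  apply: ereal_inf_lbound; exists (r * cos (0 + angle n 0), r * sin (0 + angle n 0)).
    by exists 0%N => //=; exact: ltnW (ltnW n2).
  by rewrite sqdist_polar angle0 addr0 /dot /dir/= cos0 sin0 mulr1 mulr0 addr0.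
apply: le_ereal_inf_tmp => _ [_ [k _ <-] <-].
by rewrite lee_fin sqdist_polar add0r lerB// ler_wpM2l ?mulr_ge0.
Qed.

Lemma mindist_setU alpha beta x :
  mindist (alpha `|` beta) x = mine (mindist alpha x) (mindist beta x).
Proof.
apply/eqP; rewrite eq_le le_min; apply/andP; split.
  by apply/andP; split; apply: ereal_inf_le_tmp; apply: image_subset => a;
    [left|right].
apply: le_ereal_inf_tmp => _ [a [aa|ba] <-]; rewrite ge_min.
  by rewrite ereal_inf_lbound//; exists a.
by apply/orP; right; apply: ereal_inf_lbound; exists a.
Qed.

Lemma mindist_set1 (a x : R * R) : mindist [set a] x = (sqdist x a)%:E.
Proof. by rewrite /mindist image_set1 ereal_inf1. Qed.

End distortion.

(** * Regular polygons, and squares with their center *)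

Section polygons.
Context {R : realType}.
Local Notation mu := (@lebesgue_measure R).
Local Notation mu2 := (mu \x mu)%E.
Local Notation P := (uniform_disc R).
Implicit Types (x : R * R) (alpha : set (R * R)).

Lemma measurable_dotD (c : R) :
  measurable_fun setT (fun x : R * R => (dot x x + c)%:E).
Proof.
apply/measurable_EFinP; apply: measurable_funD => //.
by apply: measurable_funD; apply: measurable_funM.
Qed.

Lemma dot_ge0 x : 0 <= dot x x.
Proof. by rewrite /dot -!expr2 addr_ge0 ?sqr_ge0. Qed.

Lemma integral_disc_dotD (c : R) : 0 <= c ->
  (\int[mu2]_(x in unit_disc) (dot x x + c)%:E = (pi / 2 + c * pi)%:E)%E.
Proof.
move=> c0; rewrite EFinD -integral_disc_dot -integral_disc_cst//.
rewrite -ge0_integralD//.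
- exact: measurable_unit_disc.
- by move=> x _; rewrite lee_fin dot_ge0.
- apply: measurable_funTS.
  rewrite (_ : (fun _ => _) = (fun x => (dot x x + 0)%:E)).
    exact: measurable_dotD.
  by apply/funext => x; rewrite addr0.
Qed.

Lemma integral_disc_sector_dotD n (c : R) : (2 < n)%N -> 0 <= c ->
  (\int[mu2]_(x in unit_disc `&` sector n) (dot x x + c)%:E =
   ((pi / 2 + c * pi) / n%:R)%:E)%E.
Proof.
move=> n2 c0; have n0 : n%:R != 0 :> R by rewrite pnatr_eq0 -lt0n (ltn_trans _ n2).
have E : ((pi / 2 + c * pi)%:E =
    n%:R%:E * \int[mu2]_(x in unit_disc `&` sector n) (dot x x + c)%:E)%E.
  rewrite -integral_disc_dotD//.
  apply: (integral_sector n2 (@measurable_unit_disc R) (@unit_disc_rotate R)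
    (measurable_dotD c)).
  - by move=> x; rewrite lee_fin addr_ge0// dot_ge0.
  - by move=> x; rewrite dot_rotate.
by rewrite mulrC EFinM E muleA -EFinM mulVf// mul1e.
Qed.

Lemma distortion_sector n m alpha : (2 < n)%N -> (alpha #<= `I_m)%card ->
  rotate (angle n 1) @` alpha = alpha ->
  (distortion P alpha = (n%:R / pi)%:E *
   \int[mu2]_(x in unit_disc `&` sector n) mindist alpha x)%E.
Proof.
move=> n2 am ra; rewrite (distortionE am) mulrC EFinM -muleA; congr (_ * _)%E.
apply: (integral_sector n2 (@measurable_unit_disc R) (@unit_disc_rotate R)
  (measurable_mindist am) (@mindist_ge0 _ _)).
by move=> x; rewrite -{1}ra mindist_rotate.
Qed.

(** For [n > 2], the mean under the uniform distribution of the largest dot product of a point with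
    the [n] vertex directions; also the distance from the origin to the centroid of a sector of the
    disc. *)
Definition polygon_moment n : R := 2 / 3 * n%:R * sin (pi / n%:R) / pi.

Lemma measurable_abs1 (c : R) :
  measurable_fun setT (fun x : R * R => (c * `|x.1|)%:E).
Proof.
apply/measurable_EFinP; apply: measurable_funM => //.
by apply: measurableT_comp => //; exact: measurable_fst.
Qed.

Lemma sector_ge0 n x : (2 < n)%N -> sector n x -> 0 <= x.1.
Proof.
move=> n2; rewrite /sector/= => h; have s0 := @sin_pidiv_gt0 R n n2.
rewrite -(pmulr_lge0 _ s0); apply: le_trans h.
by rewrite mulr_ge0// ltW// cos_pidiv_gt0.
Qed.

Lemma integral_disc_sector_absM n (c : R) : (2 < n)%N -> 0 <= c ->
  (\int[mu2]_(x in unit_disc `&` sector n) (c * `|x.1|)%:E =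
   (c * (2 / 3 * sin (pi / n%:R)))%:E)%E.
Proof.
move=> n2 c0; under eq_integral do rewrite EFinM.
have m1 : measurable_fun setT (fun x : R * R => `|x.1|%:E).
  by have := measurable_abs1 1; under eq_fun do rewrite mul1r.
rewrite ge0_integralZl//; last 2 first.
- exact: measurable_disc_sector.
- exact: measurable_funTS.
by rewrite integral_disc_sector_abs1// -EFinM.
Qed.

Lemma distortion_polygon n (r t : R) : (2 < n)%N -> 0 <= r ->
  distortion P (polygon n r t) =
  (1 / 2 + r ^+ 2 - 2 * r * polygon_moment n)%:E.
Proof.
move=> n2 r0; have n0 : (0 < n)%N by exact: ltn_trans n2.
rewrite polygon_rotate (distortion_rotate _ (@polygon_card _ n r 0)).
rewrite (distortion_sector n2 (@polygon_card _ n r 0)); last first.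
  exact: polygon_rotate_angle.
set A := unit_disc `&` sector n.
have mA : measurable A by exact: measurable_disc_sector.
have mm := measurable_mindist (@polygon_card R n r 0).
have := @integral_disc_sector_dotD n (r ^+ 2) n2 (sqr_ge0 r).
(* The linear term is moved across so that additivity for nonnegative functions applies; the total
   being finite then forces the remaining integral to be a real [K]. *)
rewrite (_ : integral _ _ _ = \int[mu2]_(x in A) mindist (polygon n r 0) x +
    \int[mu2]_(x in A) (2 * r * `|x.1|)%:E)%E; last first.
  rewrite -ge0_integralD//; last 4 first.
  - by move=> x _; exact: mindist_ge0.
  - exact: measurable_funTS.
  - by move=> x _; rewrite lee_fin !mulr_ge0.
  - by apply: measurable_funTS; exact: measurable_abs1.
  apply: eq_integral => x /set_mem[_ Sx].
  rewrite mindist_polygon_sector// -EFinD; congr EFin.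
  by rewrite ger0_norm ?subrK//; exact: sector_ge0 Sx.
rewrite integral_disc_sector_absM// ?mulr_ge0//.
case: (\int[mu2]_(x in A) _)%E => [K||]//; rewrite -EFinD => -[KE].
rewrite -EFinM; congr EFin; rewrite /polygon_moment.
have n0' : n%:R != 0 :> R by rewrite pnatr_eq0 -lt0n.
have pi0 : pi != 0 :> R by rewrite gt_eqF// pi_gt0.
have -> : K = (pi / 2 + r ^+ 2 * pi) / n%:R - 2 * r * (2 / 3 * sin (pi / n%:R)).
  by rewrite -KE addrK.
move: (sin _) => s; move: (pi : R) pi0 => p p0; by field; rewrite n0' p0.
Qed.

Definition square0 (r t : R) : set (R * R) := [set (0, 0)] `|` polygon 4 r t.

Lemma square0_rotate r t : square0 r t = rotate t @` square0 r 0.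
Proof.
rewrite /square0 image_setU -polygon_rotate image_set1; congr (_ `|` _).
by rewrite /rotate /lin2/= !mulr0 addr0.
Qed.

Lemma finite_square0 r t : exists m, (square0 r t #<= `I_m)%card.
Proof.
apply/finite_set_leP; rewrite finite_setU; split; first exact: finite_set1.
by apply/finite_set_leP; exists 4; exact: polygon_card.
Qed.

(* The case rho = 1 serves radii r >= 1: on the disc, the distances to the four
   vertices increase with r beyond 1. *)
Lemma distortion_square0 (r t rho : R) : 0 < r -> 0 < rho <= r ->
  (rho = r \/ rho = 1) ->
  ((1 / 2 + rho ^+ 2 - 2 * rho * polygon_moment 4 - rho ^+ 4 / (3 * pi))%:E <=
   distortion P (square0 r t))%E.
Proof.
move=> r0 /andP[rho0 rhor] rhoE.
have [m am] := finite_square0 r 0.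
rewrite square0_rotate (distortion_rotate _ am).
have n2 : (2 < 4)%N by [].
rewrite (distortion_sector n2 am); last first.
  rewrite /square0 image_setU image_set1 polygon_rotate_angle//; congr (_ `|` _).
  by rewrite /rotate /lin2/= !mulr0 addr0.
set A := unit_disc `&` sector 4.
have mA : measurable A by exact: measurable_disc_sector.
have mm := measurable_mindist am.
have mT : measurable_fun setT
    (fun x : R * R => (Num.max 0 (rho ^+ 2 - 2 * rho * x.1))%:E).
  apply/measurable_EFinP; apply: measurable_maxr => //.
  by apply: measurable_funB => //; apply: measurable_funM.
have T0 x : (0 <= (Num.max 0 (rho ^+ 2 - 2 * rho * x.1))%:E)%E.
  by rewrite lee_fin le_max lexx.
(* Pointwise, with [q = r^2 - 2 r x.1], [mindist] is the squared norm plus [min 0 q], and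
   [min 0 q = q - max 0 q] is nondecreasing in [q], so [q] may be replaced by its smaller value at
   [rho]. *)
have le1 : (\int[mu2]_(x in A) (dot x x + rho ^+ 2)%:E <=
    \int[mu2]_(x in A) mindist (square0 r 0) x +
    \int[mu2]_(x in A) (2 * rho * `|x.1|)%:E +
    \int[mu2]_(x in A) (Num.max 0 (rho ^+ 2 - 2 * rho * x.1))%:E)%E.
  rewrite -ge0_integralD//; last 4 first.
  - by move=> x _; exact: mindist_ge0.
  - exact: measurable_funTS.
  - by move=> x _; rewrite lee_fin !mulr_ge0// ltW.
  - by apply: measurable_funTS; exact: measurable_abs1.
  have m2 : measurable_fun setT (fun x : R * R =>
      mindist (square0 r 0) x + (2 * rho * `|x.1|)%:E)%E.
    by apply: emeasurable_funD => //; exact: measurable_abs1.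
  have p2 x : (0 <= mindist (square0 r 0) x + (2 * rho * `|x.1|)%:E)%E.
    by rewrite adde_ge0 ?mindist_ge0// lee_fin !mulr_ge0// ltW.
  rewrite -ge0_integralD//; last 2 first.
  - exact: measurable_funTS.
  - exact: measurable_funTS.
  apply: ge0_le_integral => //.
  - by move=> x _; rewrite lee_fin addr_ge0 ?dot_ge0 ?sqr_ge0.
  - by apply: measurable_funTS; exact: measurable_dotD.
  - by apply: measurable_funTS; apply: emeasurable_funD.
  move=> x [Dx Sx]; have x0 : 0 <= x.1 by exact: sector_ge0 Sx.
  have x1 : x.1 <= 1.
    have : x.1 ^+ 2 <= 1 by apply: le_trans Dx; rewrite lerDl sqr_ge0.
    by rewrite expr_le1.
  rewrite mindist_setU mindist_set1 mindist_polygon_sector// ?(ltW r0)//.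
  rewrite -EFin_min -!EFinD lee_fin (ger0_norm x0).
  have -> : sqdist x (0, 0) = dot x x by rewrite /sqdist /dot/= !subr0 !expr2.
  (* For [rho = 1] the difference is [(r - 1) * (r + 1 - 2 * x.1)], nonnegative because
     [x.1 <= 1 <= r]. *)
  have k : rho ^+ 2 - 2 * rho * x.1 <= r ^+ 2 - 2 * r * x.1.
    case: rhoE => [->//|rho1]; rewrite rho1 in rhor *.
    by nra.
  rewrite minEle maxEle; case: ifPn => h1; case: ifPn => h2; lra.
(* Passing from the sector of the disc to the whole sector can only increase the saving. *)
have le2 : (\int[mu2]_(x in A) (Num.max 0 (rho ^+ 2 - 2 * rho * x.1))%:E <=
    (rho ^+ 4 / 12)%:E)%E.
  rewrite -integral_sector4_maxr//; apply: ge0_subset_integral => //.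
  - exact: measurable_sector.
  - exact: measurable_funTS.
  - by move=> x [].
have : (((pi / 2 + rho ^+ 2 * pi) / 4)%:E <=
    \int[mu2]_(x in A) mindist (square0 r 0) x +
    (2 * rho * (2 / 3 * sin (pi / 4)))%:E + (rho ^+ 4 / 12)%:E)%E.
  rewrite -(@integral_disc_sector_dotD 4)// ?sqr_ge0//.
  have c0 : 0 <= 2 * rho by rewrite mulr_ge0// ltW.
  rewrite -(@integral_disc_sector_absM 4 _ _ c0)//.
  by apply: le_trans le1 _; rewrite leeD2l.
have : (0 <= \int[mu2]_(x in A) mindist (square0 r 0) x)%E.
  by apply: integral_ge0 => x _; exact: mindist_ge0.
have pi0 := @pi_gt0 R.
case: (\int[mu2]_(x in A) _)%E => [K||]//; last first.
  by move=> _ _; rewrite gt0_muley ?leey// lte_fin divr_gt0.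
move=> _; rewrite -!EFinD lee_fin => h; rewrite -EFinM lee_fin.
rewrite /polygon_moment.
have -> : 4 / pi * K = K * 4 / pi by rewrite mulrC mulrA.
rewrite ler_pdivlMr//.
have -> : (1 / 2 + rho ^+ 2 - 2 * rho * (2 / 3 * 4 * sin (pi / 4) / pi) -
    rho ^+ 4 / (3 * pi)) * pi =
    pi / 2 + rho ^+ 2 * pi - 2 * rho * (2 / 3 * 4 * sin (pi / 4)) - rho ^+ 4 / 3.
  move: (sin _) => s; move: (pi : R) pi0 => p p0; field.
  by rewrite gt_eqF.
lra.
Qed.

End polygons.

(** * Existence of optimal sets *)

Section existence.
Context {R : realType}.
Local Notation mu := (@lebesgue_measure R).
Local Notation mu2 := (mu \x mu)%E.
Local Notation P := (uniform_disc R).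
Implicit Types (x : R * R) (alpha : set (R * R)).

(** [P] has mass one and lives on the disc, so a pointwise comparison there passes to the
    distortions with the same constant. With [c = 0] it handles clamping, with [c > 0] continuity
    and finiteness. *)
Lemma le_distortionD alpha beta m p (c : R) : (alpha #<= `I_m)%card ->
  (beta #<= `I_p)%card -> 0 <= c ->
  (forall x, unit_disc x -> (mindist alpha x <= mindist beta x + c%:E)%E) ->
  (distortion P alpha <= distortion P beta + c%:E)%E.
Proof.
move=> am bp c0 h; rewrite (distortionE am) (distortionE bp).
have pi0 : 0 < (pi : R) by exact: pi_gt0.
have -> : c = pi^-1 * (c * pi) by rewrite mulrCA mulVf ?mulr1// gt_eqF.
rewrite EFinM -ge0_muleDr; last 2 first.
- by apply: integral_ge0 => x _; exact: mindist_ge0.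
- by rewrite lee_fin mulr_ge0// ltW.
rewrite lee_pmul2l ?fin_numE// ?lte_fin ?invr_gt0//.
rewrite -integral_disc_cst// -ge0_integralD//; last 3 first.
- exact: measurable_unit_disc.
- by move=> x _; exact: mindist_ge0.
- by apply: measurable_funTS; exact: measurable_mindist bp.
apply: ge0_le_integral => //.
- exact: measurable_unit_disc.
- by move=> x _; exact: mindist_ge0.
- by apply: measurable_funTS; exact: measurable_mindist am.
- apply: measurable_funTS; apply: emeasurable_funD => //.
  exact: measurable_mindist bp.
Qed.

Lemma mindist_imageD (a b : nat -> R * R) n x (c : R) :
  (forall k, (k < n)%N -> sqdist x (a k) <= sqdist x (b k) + c) ->
  (mindist (a @` `I_n) x <= mindist (b @` `I_n) x + c%:E)%E.
Proof.
move=> h; rewrite -leeBlDr//; apply: le_ereal_inf_tmp => _ [_ [k kn <-] <-].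
rewrite leeBlDr//; apply: ge_ereal_inf; exists (sqdist x (a k))%:E.
  by exists (a k) => //; exists k.
by rewrite -EFinD lee_fin h.
Qed.

Definition clamp (t : R) : R := Num.max (-1) (Num.min 1 t).

Lemma clamp_itv t : -1 <= clamp t <= 1.
Proof.
by rewrite /clamp le_max lexx/= ge_max ge_min lexx andbT; lra.
Qed.

Lemma clamp_dist (s t : R) : -1 <= s <= 1 ->
  (s - clamp t) ^+ 2 <= (s - t) ^+ 2.
Proof.
move=> /andP[s1 s2]; rewrite /clamp.
case: (leP 1 t) => h1; first by case: (leP (-1) 1) => h2; nra.
by case: (leP (-1) t) => h2; nra.
Qed.

Lemma unit_disc_itv x : unit_disc x -> (-1 <= x.1 <= 1) /\ (-1 <= x.2 <= 1).
Proof.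
have E (t : R) : t ^+ 2 <= 1 -> -1 <= t <= 1 by rewrite sqr_le1_itv in_itv.
by move=> h; split; apply: E; apply: le_trans h; rewrite ?lerDl ?lerDr sqr_ge0.
Qed.

Section configurations.
Variable n : nat.
Local Notation T := ('rV[R]_n.+1 * 'rV[R]_n.+1)%type.

(** Points are labelled, and labels may share a point, so configurations of [n.+1] labels also
    represent the smaller nonempty sets. Keeping abscissae and ordinates in separate rows makes
    [box] a product of two compact cubes. *)
Definition config_pt (v : T) (k : nat) : R * R :=
  (v.1 ord0 (inord k), v.2 ord0 (inord k)).

Definition config (v : T) : set (R * R) := config_pt v @` `I_n.+1.

Definition box : set T :=
  [set u : 'rV[R]_n.+1 | forall i, `[(-1)%R, 1%R]%classic (u ord0 i)] `*`
  [set u : 'rV[R]_n.+1 | forall i, `[(-1)%R, 1%R]%classic (u ord0 i)].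

Lemma compact_box : compact box.
Proof.
by apply: compact_setX;
  apply: (@rV_compact R _ (fun=> `[(-1)%R, 1%R]%classic)) => i;
  exact: segment_compact. Qed.

Lemma config_card v : (config v #<= `I_n.+1)%card.
Proof. exact: card_image_le. Qed.

Lemma box_ball_distortion (v w : T) (e : R) : box v -> box w -> 0 < e ->
  ball v e w ->
  (distortion P (config v) <= distortion P (config w) + (8 * e)%:E)%E.
Proof.
move=> [v1 v2] [w1 w2] e0 [[_ b1] [_ b2]].
apply: (le_distortionD (@config_card v) (@config_card w)).
  by rewrite mulr_ge0// ltW.
move=> x /unit_disc_itv[/andP[x1 x1'] /andP[x2 x2']].
apply: mindist_imageD => k kn; rewrite /sqdist /config_pt/=.
have := b1 ord0 (inord k); have := b2 ord0 (inord k).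
rewrite /ball/= !ltr_norml.
have := v1 (inord k); have := v2 (inord k).
have := w1 (inord k); have := w2 (inord k).
rewrite /= !in_itv/=.
move: (v.1 _ _) (v.2 _ _) (w.1 _ _) (w.2 _ _) => a b c d.
move=> /andP[? ?] /andP[? ?] /andP[? ?] /andP[? ?] /andP[? ?] /andP[? ?].
(* Each coordinate varies by at most [e] times [|2 s - p - q| <= 4]; the two coordinates together
   give the constant 8. *)
have key (s p q : R) : -1 <= s -> s <= 1 -> -1 <= p -> p <= 1 ->
    -1 <= q -> q <= 1 ->
    - e < p - q -> p - q < e -> (s - p) ^+ 2 <= (s - q) ^+ 2 + 4 * e.
  move=> *; have -> : (s - p) ^+ 2 = (s - q) ^+ 2 + (q - p) * (2 * s - p - q).
    by ring.
  rewrite lerD2l; apply: le_trans (ler_norm _) _; rewrite normrM mulrC.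
  by apply: ler_pM => //; rewrite ler_norml; apply/andP; split; lra.
have k1 := key x.1 a c; have k2 := key x.2 b d.
have -> : 8 * e = 4 * e + 4 * e by ring.
by rewrite addrACA; apply: lerD; [apply: k1|apply: k2].
Qed.

Lemma box_distortion_fin v : box v -> distortion P (config v) \is a fin_num.
Proof.
move=> [v1 v2]; apply/fin_numPlt; apply/andP; split.
  apply: (@lt_le_trans _ _ 0%E) => //; apply: integral_ge0 => x _.
  exact: mindist_ge0.
(* Any set of known finite distortion would do for comparison; the triangle of radius 0 has one by
   [distortion_polygon]. The 8 bounds the squared distance between two points of the square
   [[-1, 1]^2]. *)
have h x : unit_disc x ->
    (mindist (config v) x <= mindist (polygon 3 0 0) x + 8%:E)%E.
  move=> /unit_disc_itv[/andP[x1 x1'] /andP[x2 x2']].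
  apply: (@le_trans _ _ 8%:E); last by rewrite leeDr// mindist_ge0.
  apply: ge_ereal_inf; exists (sqdist x (config_pt v 0))%:E.
    by exists (config_pt v 0) => //; exists 0%N.
  rewrite lee_fin /sqdist /config_pt/=.
  have := v1 (inord 0); have := v2 (inord 0); rewrite /= !in_itv/=.
  move: (v.1 _ _) (v.2 _ _) => a b /andP[? ?] /andP[? ?].
  nra.
apply: le_lt_trans (le_distortionD (@config_card v) (@polygon_card _ 3 0 0) _ h) _.
  by [].
by rewrite distortion_polygon// -EFinD ltry.
Qed.

Lemma continuous_distortion_config :
  {within box, continuous (fun v => fine (distortion P (config v)))}.
Proof.
apply/subspace_continuousP => v bv; apply/cvgrPdist_le => e e0.
have e8 : 0 < e / 8 by rewrite divr_gt0.
near=> w.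
have bw : box w by near: w; exact: withinT.
have vw : ball v (e / 8) w.
  near: w; apply: cvg_within; exact: nbhsx_ballx.
have real_le u u' : box u -> box u' -> ball u (e / 8) u' ->
    fine (distortion P (config u)) <= fine (distortion P (config u')) + e.
  move=> bu bu' uu'; have := box_ball_distortion bu bu' e8 uu'.
  rewrite -lee_fin EFinD !fineK ?box_distortion_fin//.
  by rewrite (_ : 8 * (e / 8) = e)//; field.
have dist_le (a b : R) : a <= b + e -> b <= a + e -> `|a - b| <= e.
  by move=> ? ?; rewrite ler_norml; apply/andP; split; lra.
exact: dist_le (real_le _ _ bv bw vw) (real_le _ _ bw bv (ball_sym vw)).
Unshelve. all: by end_near.
Qed.

Lemma distortion_clamp alpha : alpha !=set0 -> (alpha #<= `I_n.+1)%card ->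
  exists2 v, box v & (distortion P (config v) <= distortion P alpha)%E.
Proof.
move=> a0 an; have [a [aE _]] := finite_range a0 an.
pose v : T := (\row_i clamp (a i).1, \row_i clamp (a i).2).
exists v; first by split => i /=; rewrite mxE in_itv/= clamp_itv.
rewrite -[leRHS]adde0; apply: (le_distortionD (@config_card v) an) => // x Dx.
rewrite aE; apply: mindist_imageD => k kn; rewrite addr0.
have [x1 x2] := unit_disc_itv Dx.
rewrite /sqdist /config_pt/= !mxE inordK//.
by rewrite lerD// clamp_dist.
Qed.

Lemma exists_optimal_means : exists alpha, optimal_means P n.+1 alpha.
Proof.
have box0 : box !=set0.
  by exists (0, 0); split => i /=; rewrite mxE in_itv/= lerN10 ler01.
have [c /set_mem bc cmin] :=
  compact_EVT_min box0 compact_box continuous_distortion_config.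
exists (config c); split; first exact: config_card.
apply/eqP; rewrite eq_le; apply/andP; split; last first.
  by apply: ereal_inf_lbound; exists (config c) => //; exact: config_card.
apply: le_ereal_inf_tmp => _ [alpha an <-].
(* The empty set is also a competitor. It has no points to clamp, but its [mindist] is [+oo]
   everywhere. *)
have [->|/set0P a0] := eqVneq alpha set0.
  have c0 : (@set0 (R * R) #<= `I_1)%card by exact: card_ge0.
  rewrite -[leRHS]adde0; apply: (le_distortionD (@config_card c) c0) => // x Dx.
  by rewrite /mindist image_set0 ereal_inf0 leey.
have [v bv] := distortion_clamp a0 an; apply: le_trans.
have := cmin v (mem_set bv).
by rewrite -lee_fin !fineK// box_distortion_fin.
Qed.

End configurations.

End existence.

(** * Numerical bounds *)

Section numerics.
Context {R : realType}.

Definition exp_term n (x : R) : R := x ^+ n / n`!%:R.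

Lemma exp_term0 n : exp_term n.+1 0 = 0.
Proof. by rewrite /exp_term expr0n mul0r. Qed.

Lemma is_derive_exp_term n (x : R) :
  is_derive x 1 (exp_term n.+1) (exp_term n x).
Proof.
have -> : exp_term n x = n.+1%:R * x ^+ n * n.+1`!%:R^-1.
  have E (a b y : R) : a != 0 -> b != 0 -> y / b = a * y * (a * b)^-1.
    by move=> a0 b0; field; rewrite a0 b0.
  by rewrite factS natrM; apply: E; rewrite pnatr_eq0 -?lt0n ?fact_gt0.
have -> : exp_term n.+1 = n.+1`!%:R^-1 *: (id : R -> R) ^+ n.+1.
  by apply/funext => y; rewrite !fctE /exp_term mulrC.
by apply: is_derive_eq; rewrite /GRing.scale/= mulr1 mulrC.
Qed.

(** Taylor polynomials at 0, named by degree. Up to sign the derivative of each is the preceding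
    one, so that bounds propagate from one to the next. *)
Definition cos2 (x : R) : R := 1 - exp_term 2 x.
Definition sin3 (x : R) : R := x - exp_term 3 x.
Definition cos4 (x : R) : R := cos2 x + exp_term 4 x.
Definition sin5 (x : R) : R := sin3 x + exp_term 5 x.
Definition cos6 (x : R) : R := cos4 x - exp_term 6 x.
Definition sin7 (x : R) : R := sin5 x - exp_term 7 x.
Definition cos8 (x : R) : R := cos6 x + exp_term 8 x.
Definition sin9 (x : R) : R := sin7 x + exp_term 9 x.

Lemma is_derive_cos2 (x : R) : is_derive x 1 cos2 (- x).
Proof.
rewrite /cos2; have d := is_derive_exp_term 1 x; apply: is_derive_eq.
by rewrite add0r mul1r /exp_term expr1 factS fact0 divr1.
Qed.

Lemma is_derive_sin3 (x : R) : is_derive x 1 sin3 (cos2 x).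
Proof. by rewrite /sin3; have d := is_derive_exp_term 2 x; apply: is_derive_eq. Qed.

Lemma is_derive_cos4 (x : R) : is_derive x 1 cos4 (- sin3 x).
Proof.
have d1 := is_derive_cos2 x; have d2 := is_derive_exp_term 3 x.
rewrite /cos4; apply: is_derive_eq.
by rewrite /sin3 ?opprD ?opprK.
Qed.

Lemma is_derive_sin5 (x : R) : is_derive x 1 sin5 (cos4 x).
Proof.
have d1 := is_derive_sin3 x; have d2 := is_derive_exp_term 4 x.
rewrite /sin5; apply: is_derive_eq.
by rewrite /cos4 ?opprD ?opprK.
Qed.

Lemma is_derive_cos6 (x : R) : is_derive x 1 cos6 (- sin5 x).
Proof.
have d1 := is_derive_cos4 x; have d2 := is_derive_exp_term 5 x.
rewrite /cos6; apply: is_derive_eq.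
by rewrite /sin5 ?opprD ?opprK.
Qed.

Lemma is_derive_sin7 (x : R) : is_derive x 1 sin7 (cos6 x).
Proof.
have d1 := is_derive_sin5 x; have d2 := is_derive_exp_term 6 x.
rewrite /sin7; apply: is_derive_eq.
by rewrite /cos6 ?opprD ?opprK.
Qed.

Lemma is_derive_cos8 (x : R) : is_derive x 1 cos8 (- sin7 x).
Proof.
have d1 := is_derive_cos6 x; have d2 := is_derive_exp_term 7 x.
rewrite /cos8; apply: is_derive_eq.
by rewrite /sin7 ?opprD ?opprK.
Qed.

Lemma is_derive_sin9 (x : R) : is_derive x 1 sin9 (cos8 x).
Proof.
have d1 := is_derive_sin7 x; have d2 := is_derive_exp_term 8 x.
rewrite /sin9; apply: is_derive_eq.
by rewrite /cos8 ?opprD ?opprK.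
Qed.

Lemma sin7E (x : R) :
  sin7 x = x - x ^+ 3 / 6 + x ^+ 5 / 120 - x ^+ 7 / 5040.
Proof.
rewrite /sin7 /sin5 /sin3 /exp_term !factS fact0 !natrM.
by congr (_ - _ / _ + _ / _ - _ / _); ring.
Qed.

Lemma sin9E (x : R) : sin9 x =
  x - x ^+ 3 / 6 + x ^+ 5 / 120 - x ^+ 7 / 5040 + x ^+ 9 / (72 * 5040).
Proof.
rewrite /sin9 sin7E /exp_term !factS fact0 !natrM.
by congr (_ + _ / _); ring.
Qed.

Lemma ge0_le_derive (f g f' g' : R -> R) :
  (forall x : R, is_derive x 1 f (f' x)) ->
  (forall x : R, is_derive x 1 g (g' x)) ->
  f 0 = g 0 -> (forall x, 0 <= x -> f' x <= g' x) ->
  forall x, 0 <= x -> f x <= g x.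
Proof.
move=> df dg fg0 le' x; rewrite le_eqVlt => /predU1P[<-|x0].
  by rewrite fg0.
have dh (t : R) : is_derive t 1 (g - f) (g' t - f' t) by apply: is_deriveB.
have ch : {within `[0, x], continuous (g - f)}.
  apply: continuous_subspaceT => t; apply: differentiable_continuous.
  by apply/derivable1_diffP; apply: ex_derive.
have [c /itvP cI] := MVT x0 (fun t _ => dh t) ch.
rewrite !fctE fg0 subrr subr0 => e.
rewrite -subr_ge0 e subr0 mulr_ge0//; last exact: ltW.
by rewrite subr_ge0 le'// cI.
Qed.

(** Starting from [cos <= 1], a bound on the derivative is integrated from 0 nine times; the
    direction flips at each passage from sine to cosine. *)
Lemma sin_taylor_bounds (x : R) : 0 <= x -> sin7 x <= sin x <= sin9 x.
Proof.
have ds (t : R) : is_derive t 1 (@sin R) (cos t) by exact: is_derive_sin.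
have dc (t : R) : is_derive t 1 (@cos R) (- sin t) by exact: is_derive_cos.
have E1 (t : R) : 0 <= t -> sin t <= t.
  have di (u : R) : is_derive u 1 (id : R -> R) ((fun=> 1) u).
    exact: is_derive_id.
  apply: (ge0_le_derive ds di); first by rewrite sin0.
  by move=> u _; exact: cos_le1.
have E2 (t : R) : 0 <= t -> cos2 t <= cos t.
  apply: (ge0_le_derive is_derive_cos2 dc) => [|u u0]; last by rewrite lerN2 E1.
  by rewrite /cos2 cos0 ?exp_term0 ?subr0 ?addr0.
have E3 (t : R) : 0 <= t -> sin3 t <= sin t.
  apply: (ge0_le_derive is_derive_sin3 ds) => //.
  by rewrite /sin3 sin0 ?exp_term0 ?subr0 ?addr0.
have E4 (t : R) : 0 <= t -> cos t <= cos4 t.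
  apply: (ge0_le_derive dc is_derive_cos4) => [|u u0]; last by rewrite lerN2 E3.
  by rewrite /cos4 /cos2 cos0 ?exp_term0 ?subr0 ?addr0.
have E5 (t : R) : 0 <= t -> sin t <= sin5 t.
  apply: (ge0_le_derive ds is_derive_sin5) => //.
  by rewrite /sin5 /sin3 sin0 ?exp_term0 ?subr0 ?addr0.
have E6 (t : R) : 0 <= t -> cos6 t <= cos t.
  apply: (ge0_le_derive is_derive_cos6 dc) => [|u u0]; last by rewrite lerN2 E5.
  by rewrite /cos6 /cos4 /cos2 cos0 ?exp_term0 ?subr0 ?addr0.
have E7 (t : R) : 0 <= t -> sin7 t <= sin t.
  apply: (ge0_le_derive is_derive_sin7 ds) => //.
  by rewrite /sin7 /sin5 /sin3 sin0 ?exp_term0 ?subr0 ?addr0.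
have E8 (t : R) : 0 <= t -> cos t <= cos8 t.
  apply: (ge0_le_derive dc is_derive_cos8) => [|u u0]; last by rewrite lerN2 E7.
  by rewrite /cos8 /cos6 /cos4 /cos2 cos0 ?exp_term0 ?subr0 ?addr0.
have E9 (t : R) : 0 <= t -> sin t <= sin9 t.
  apply: (ge0_le_derive ds is_derive_sin9) => //.
  by rewrite /sin9 /sin7 /sin5 /sin3 sin0 ?exp_term0 ?subr0 ?addr0.
by move=> x0; rewrite E7// E9.
Qed.

Lemma sin_pi6 : sin (pi / 6) = 1 / 2 :> R.
Proof.
set a : R := pi / 6; have p2 := @pi_ge2 R.
have sa : 0 < sin a by apply: sin_gt0_pihalf; rewrite /a; lra.
have : sin (a + a + a) = 1 by rewrite -[RHS]sin_pihalf; congr sin; rewrite /a; field.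
rewrite !sinD cosD; have := cos2Dsin2 a; move: (cos a) (sin a) sa => c s s0 cs.
have c2 : c * c = 1 - s * s by rewrite -!expr2 -cs; ring.
have -> : (s * c + c * s) * c + (c * c - s * s) * s = 3 * (c * c) * s - s ^+ 3.
  by ring.
rewrite c2 => h.
(* This product is [4 s^3 - 3 s + 1], that is [1 - sin (3 a)]. *)
have : (s + 1) * (2 * s - 1) ^+ 2 = 0.
  have -> : (s + 1) * (2 * s - 1) ^+ 2 = 1 - (3 * (1 - s * s) * s - s ^+ 3) by ring.
  by rewrite h subrr.
move=> /eqP; rewrite mulf_eq0 expf_eq0/= => /orP[] /eqP; lra.
Qed.

(** The exact value of [sin (pi / 6)] traps pi: the Taylor bounds at [lo / 6] and [hi / 6] fall on
    either side of [1 / 2], and sine is increasing there. Placing these arguments below [pi / 2]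
    takes only [pi >= 2]. *)
Lemma pi_bounds : (314 + 159 / 10 ^+ 3) / 10 ^+ 2 < (pi : R) <
  (314 + 16 / 10 ^+ 2) / 10 ^+ 2.
Proof.
have p2 := @pi_ge2 R.
set lo : R := _ / 10 ^+ 2; set hi : R := (_ + 16 / _) / _.
have lo4 : 0 <= lo <= 4 by rewrite /lo; apply/andP; split; lra.
have hi4 : 0 <= hi <= 4 by rewrite /hi; apply/andP; split; lra.
have lo6 : 0 <= lo / 6 by lra.
have hi6 : 0 <= hi / 6 by lra.
have l1 : sin (lo / 6) < sin (pi / 6).
  rewrite sin_pi6; have /andP[_ l] := sin_taylor_bounds lo6; apply: le_lt_trans l _.
  by rewrite sin9E /lo; lra.
have l2 : sin (pi / 6) < sin (hi / 6).
  rewrite sin_pi6; have /andP[l _] := sin_taylor_bounds hi6; apply: lt_le_trans l.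
  by rewrite sin7E /hi; lra.
have I (t : R) : 0 <= t <= 4 -> t / 6 \in `[(- (pi / 2)), pi / 2].
  by move=> /andP[? ?]; rewrite in_itv/=; apply/andP; split; lra.
have Ipi : pi / 6 \in `[(- (pi / 2)), (pi : R) / 2].
  by rewrite in_itv/=; apply/andP; split; lra.
rewrite ltr_sin// ?I// in l1; rewrite ltr_sin// ?I// in l2.
by apply/andP; split; lra.
Qed.

(** With [y = pi / 5] the moment is [2 / 3 * (sin y / y)], and the quotient is even in [y], hence
    controlled by [u = y ^+ 2]. It varies slowly in [u], which keeps the uncertainty on pi within
    the tolerance. *)
Lemma sqr_moment5_bounds :
  `|(polygon_moment 5 : R) ^+ 2 - (388 / 10 ^+ 3 + 951 / 10 ^+ 6)| < 10 ^- 6.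
Proof.
have /andP[plo phi] := pi_bounds.
pose y : R := pi / 5.
have ME : (polygon_moment 5 : R) = 2 / 3 * (sin y / y).
  rewrite /polygon_moment -/y; have p0 : (pi : R) != 0 by rewrite gt_eqF ?pi_gt0.
  rewrite /y; move: (sin _) => s; move: (pi : R) p0 => p p0; by field.
have y0 : 0 < y by rewrite divr_gt0 ?pi_gt0.
have /andP[sl su] := sin_taylor_bounds (ltW y0).
pose u := y ^+ 2.
have ulo : (394 + 783 / 10 ^+ 3) / 10 ^+ 3 <= u.
  have : (628 + 318 / 10 ^+ 3) / 10 ^+ 3 <= y by rewrite /y; lra.
  rewrite /u; move: y y0 {sl su ME u} => y y0 h; nra.
have uhi : u <= (394 + 787 / 10 ^+ 3) / 10 ^+ 3.
  have : y <= (628 + 32 / 10 ^+ 2) / 10 ^+ 3 by rewrite /y; lra.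
  rewrite /u; move: y y0 {sl su ME u ulo} => y y0 h; nra.
have u0 : 0 <= u by lra.
set ul : R := _ / _ in ulo; set uh : R := _ / _ in uhi.
have ul0 : 0 <= ul by rewrite /ul; lra.
have uh0 : 0 <= uh by rewrite /uh; lra.
have pl k : ul ^+ k <= u ^+ k by rewrite lerXn2r.
have ph k : u ^+ k <= uh ^+ k by rewrite lerXn2r.
(* The terms alternate in sign: [uh] goes into the negative ones and [ul] into the positive ones,
   and conversely for the upper bound. *)
have zl : 1 - uh / 6 + ul ^+ 2 / 120 - uh ^+ 3 / 5040 <= sin y / y.
  rewrite ler_pdivlMr//; apply: le_trans sl.
  have -> : sin7 y = (1 - u / 6 + u ^+ 2 / 120 - u ^+ 3 / 5040) * y.
    by rewrite sin7E /u; field.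
  by rewrite ler_pM2r//; have := pl 2; have := ph 3; lra.
have zu : sin y / y <=
    1 - ul / 6 + uh ^+ 2 / 120 - ul ^+ 3 / 5040 + uh ^+ 4 / (72 * 5040).
  rewrite ler_pdivrMr//; apply: le_trans su _.
  have -> : sin9 y =
      (1 - u / 6 + u ^+ 2 / 120 - u ^+ 3 / 5040 + u ^+ 4 / (72 * 5040)) * y.
    by rewrite sin9E /u; field.
  by rewrite ler_pM2r//; have := pl 3; have := ph 2; have := ph 4; lra.
rewrite ME; move: (sin y / y) zl zu => z zl zu.
have zl' : (935 + 488 / 10 ^+ 3) / 10 ^+ 3 <= z.
  by apply: le_trans zl; rewrite /ul /uh; lra.
have zu' : z <= (935 + 490 / 10 ^+ 3) / 10 ^+ 3.
  by apply: le_trans zu _; rewrite /ul /uh; lra.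
clear -zl' zu'.
have z2l : ((935 + 488 / 10 ^+ 3) / 10 ^+ 3) ^+ 2 <= z ^+ 2.
  by rewrite lerXn2r// nnegrE; lra.
have z2u : z ^+ 2 <= ((935 + 490 / 10 ^+ 3) / 10 ^+ 3) ^+ 2.
  by rewrite lerXn2r// nnegrE; lra.
rewrite exprMn ltr_norml; apply/andP; split; lra.
Qed.

Lemma moment4_bound : (polygon_moment 4 : R) <= 6003 / 10 ^+ 4.
Proof.
have /andP[plo phi] := pi_bounds; have p0 := @pi_gt0 R.
have s2 : sin (pi / 4) <= (7072 / 10 ^+ 4 : R).
  have n2 : (2 < 4)%N by [].
  have c0 := @cos_pidiv_gt0 R 4 n2; have s0 := @sin_pidiv_gt0 R 4 n2.
  have := @tan_piquarter R; rewrite /tan => /(canRL (divfK _)).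
  rewrite gt_eqF// mul1r => /(_ isT) e.
  have := cos2Dsin2 (pi / 4 : R); rewrite -e => h.
  move: (sin (pi / 4)) s0 h => s s0 h; nra.
rewrite /polygon_moment ler_pdivrMr//.
move: (sin _) s2 => s s2; lra.
Qed.

(** The gap is about one hundredth, so coarse constants suffice: 0.3885 below the squared fifth
    moment, 0.6003 above the fourth moment, 0.1063 above [1 / (3 pi)]. *)
Lemma square0_gap (rho : R) : 0 < rho <= 1 ->
  1 / 2 - (polygon_moment 5 : R) ^+ 2 <
  1 / 2 + rho ^+ 2 - 2 * rho * (polygon_moment 4 : R) - rho ^+ 4 / (3 * pi).
Proof.
move=> /andP[r0 r1]; have m4 := moment4_bound; have := sqr_moment5_bounds.
rewrite ltr_norml => /andP[m5 _].
have q : rho ^+ 4 / (3 * pi) <= rho ^+ 4 * (1063 / 10 ^+ 4).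
  rewrite ler_wpM2l ?exprn_ge0 ?(ltW r0)//.
  have /andP[plo phi] := pi_bounds; have p0 := @pi_gt0 R.
  rewrite -[leLHS]mul1r ler_pdivrMr ?mulr_gt0//; lra.
have k : rho * (polygon_moment 4 : R) <= rho * (6003 / 10 ^+ 4) by rewrite ler_pM2l.
have : 0 < 3885 / 10 ^+ 4 + rho ^+ 2 - 2 * rho * (6003 / 10 ^+ 4)
    - rho ^+ 4 * (1063 / 10 ^+ 4).
  (* Expansion at 33/50, near the minimum, where the remainder is positive. *)
  have s0 : 0 <= 1 - 1063 / 10 ^+ 4 *
      (rho ^+ 2 + 2 * (33 / 50) * rho + 3 * (33 / 50) ^+ 2).
    have : rho ^+ 2 <= 1 by rewrite expr_le1// ltW.
    lra.
  have := mulr_ge0 (sqr_ge0 (rho - 33 / 50)) s0.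
  lra.
lra.
Qed.

End numerics.

(** * Optimal sets of five means *)

Section five_means.
Context {R : realType}.
Local Notation P := (uniform_disc R).
Local Notation M := (polygon_moment 5 : R).

Lemma moment5_gt0 : 0 < M.
Proof.
by rewrite /polygon_moment divr_gt0 ?pi_gt0// mulr_gt0// sin_pidiv_gt0.
Qed.

Lemma distortion_pentagon_opt t :
  distortion P (polygon 5 M t) = (1 / 2 - M ^+ 2)%:E.
Proof.
by rewrite distortion_polygon// ?(ltW moment5_gt0)//; congr EFin; ring.
Qed.

Lemma optimal_le_pentagon alpha : optimal_means P 5 alpha ->
  (distortion P alpha <= (1 / 2 - M ^+ 2)%:E)%E.
Proof.
move=> [_ ->]; rewrite -(distortion_pentagon_opt 0).
by apply: ereal_inf_lbound; exists (polygon 5 M 0) => //; exact: polygon_card.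
Qed.

Lemma square0_not_optimal r t : 0 < r -> ~ optimal_means P 5 (square0 r t).
Proof.
move=> r0 /optimal_le_pentagon; apply/negP; rewrite -ltNge.
pose rho := Num.min r 1.
have rho1 : 0 < rho <= 1 by rewrite /rho lt_min r0 ltr01 ge_min lexx orbT.
have rhor : 0 < rho <= r by rewrite /rho lt_min r0 ltr01 ge_min lexx.
have rhoE : rho = r \/ rho = 1 by rewrite /rho minEle; case: ifP; [left|right].
apply: lt_le_trans (distortion_square0 t r0 rhor rhoE).
by rewrite lte_fin square0_gap.
Qed.

Lemma optimal_pentagon_radius r t : 0 < r ->
  optimal_means P 5 (polygon 5 r t) -> r = M.
Proof.
move=> r0 /optimal_le_pentagon; rewrite distortion_polygon ?(ltW r0)// lee_fin => h.
apply/eqP; rewrite -subr_eq0 -sqrf_eq0 eq_le sqr_ge0 andbT.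
by rewrite sqrrB; lra.
Qed.

Lemma polygon_circle0 n (r t : R) : polygon n r t `<=` circle0 (r ^+ 2).
Proof.
move=> _ [k _ <-]; rewrite /circle0/= !exprMn -mulrDr cos2Dsin2 mulr1.
by [].
Qed.

(** Different phases may give the same pentagon, so points are counted instead of sets: a countable
    family of finite sets has a countable union, yet the abscissae of the vertices fill [[-r, r]].
    The vertex at phase [acos y] has abscissa [r * y]. *)
Lemma uncountable_polygons (S : set (set (R * R))) r : 0 < r ->
  (forall t, S (polygon 5 r t)) ->
  (forall alpha, S alpha -> (alpha #<= `I_5)%card) -> ~ countable S.
Proof.
move=> r0 Sr S5 cS.
have cU : countable (\bigcup_(alpha in S) alpha).
  apply: bigcup_countable => // alpha Sa; apply: finite_set_countable.
  by apply/finite_set_leP; exists 5; exact: S5.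
have sub : `[(-1)%R, 1%R]%classic `<=`
    (fun x : R * R => x.1 / r) @` \bigcup_(alpha in S) alpha.
  move=> y yI; exists (r * y, r * sin (acos y)).
    exists (polygon 5 r (acos y)) => //; exists 0%N => //=.
    by rewrite angle0 addr0 acosK.
  by rewrite /= mulrC mulrA mulVf ?mul1r// gt_eqF.
have := card_le_trans (subset_card_le sub) (card_image_le _ _).
move=> /sub_countable/(_ cU).
move=> /countable_lebesgue_measure0; rewrite lebesgue_itvcc ?ge0_cp// => -[].
lra.
Qed.

End five_means.

Theorem theorem2p10p1 (R : realType)
    (hshape : forall alpha : set (R * R),
      optimal_means (uniform_disc R) 5%N alpha ->
      regular_polygon0 5%N alpha \/
      exists sq : set (R * R),
        regular_polygon0 4%N sq /\ alpha = [set (0, 0)] `|` sq) :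
  [/\ ~ countable [set alpha | optimal_means (uniform_disc R) 5%N alpha],
      (`| quantization_error (uniform_disc R) 5%N
          - (111 / 10 ^+ 3 + 49 / 10 ^+ 6)%:E | < (10 ^- 6)%:E)%E &
      exists c : R,
        `| c - (388 / 10 ^+ 3 + 951 / 10 ^+ 6) | < 10 ^- 6 /\
        forall alpha : set (R * R),
          optimal_means (uniform_disc R) 5%N alpha ->
          regular_polygon0 5%N alpha /\ alpha `<=` circle0 c].
Proof.
pose M : R := polygon_moment 5.
have shape alpha : optimal_means (uniform_disc R) 5 alpha ->
    exists t, alpha = polygon 5 M t.
  move=> opt; case: (hshape _ opt) => [[r [t [r0 E]]]|[_ [[r [t [r0 ->]]] E]]].
    have {}E : alpha = polygon 5 r t by [].
    exists t; rewrite E; congr polygon.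
    by apply: (optimal_pentagon_radius (t := t)) => //; rewrite -E.
  have {}E : alpha = square0 r t by [].
  by case: (square0_not_optimal (t := t) r0); rewrite -E.
have VE : quantization_error (uniform_disc R) 5 = (1 / 2 - M ^+ 2)%:E.
  (* The argument 4 means five points, as [exists_optimal_means] is stated for [n.+1]. *)
  have [alpha opt] := @exists_optimal_means R 4.
  have [t alphaE] := shape _ opt.
  by rewrite -opt.2 alphaE distortion_pentagon_opt.
have opt t : optimal_means (uniform_disc R) 5 (polygon 5 M t).
  by split; [exact: polygon_card|rewrite VE distortion_pentagon_opt].
split.
- by apply: (uncountable_polygons moment5_gt0 opt) => alpha [].
(* Since 0.111049 + 0.388951 = 1 / 2, the error on the quantization error is the opposite of the
   error on [M ^+ 2], and one numerical bound serves both claims. *)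
- rewrite VE -EFinB abse_EFin lte_fin distrC.
  have := @sqr_moment5_bounds R.
  by congr (`|_| < _); rewrite /M; lra.
exists (M ^+ 2); split; first exact: sqr_moment5_bounds.
move=> alpha /shape[t ->]; split; last exact: polygon_circle0.
by exists M, t; split; [exact: moment5_gt0|].
Qed.
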